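(* Let $\epsilon>0$ be a small enough constant and let $\delta>0$ be such that $\delta\le \epsilon^4$. Let $G=(V,E)$ be an $(n,d,\lambda)$-graph with $\frac{\lambda}{d}\le \delta$. Let $p=\frac{1+\epsilon}{d}$. Form $G_p$ by retaining every edge of $G$ independently with probability $p$. Let $L_1$ be the largest connected component of $G_p$. Then there exists an absolute constant $c>0$ such that with high probability, for any $S\subseteq L_1$: (1) if $\frac{16\ln n}{\epsilon^2}\le |S| \le \frac{\epsilon^2 n}{50}$ and $S$ spans a connected subgraph in $G_p$ (that is, $G_p[S]$ is connected), then $$\big|N_{G_p}(S)\big|\ge\frac{c\,\epsilon^2|S|}{\ln\left(\frac{1}{\epsilon}\right)};$$ and (2) if $\frac{\epsilon^2n}{50}\le |S| \le \frac{12\epsilon n}{11}$ (with $S$ not necessarily connected), then $$\big|N_{G_p}(S)\big|\ge\frac{c\,\epsilon^2|S|}{\ln^2\left(\frac{1}{\epsilon}\right)}.$$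
   Context: An $(n,d,\lambda)$-graph is a $d$-regular graph on $n$ vertices whose adjacency matrix has eigenvalues $d=\lambda_1\ge\lambda_2\ge\dots\ge\lambda_n$ with $\lambda=\max\{|\lambda_2|,|\lambda_n|\}$. For a graph $H$ and $S\subseteq V(H)$, $N_H(S)$ is the external neighbourhood of $S$ in $H$, i.e. the set of vertices of $V(H)\setminus S$ having at least one neighbour in $S$; $H[S]$ is the induced subgraph. ''With high probability'' means with probability tending to $1$ as $n\to\infty$, where $\epsilon,\delta$ are fixed and $G=G_n$ ranges over any sequence of $(n,d,\lambda)$-graphs satisfying the hypotheses ($d,\lambda$ may depend on $n$). ''$\epsilon$ small enough constant'' means that there is an absolute constant $\epsilon_0>0$ such that the statement holds for every fixed $0<\epsilon\le\epsilon_0$; ''absolute constant'' means independent of $\epsilon,\delta,n,d,\lambda,G$. The component $L_1$ is identified with its vertex set. $\ln$ is the natural logarithm. *)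

(* Defs.v *)
From HB Require Import structures.
From mathcomp Require Import all_boot all_order all_algebra.
From mathcomp Require Import boolp reals.

Set Implicit Arguments.
Unset Strict Implicit.
Unset Printing Implicit Defensive.

Import Order.TTheory GRing.Theory Num.Theory.

Local Open Scope ring_scope.

(* A simple graph on the finite vertex type [T] is represented by its edge set
   [E : {set {set T}}], all of whose members are unordered pairs; [adj E] is
   then symmetric and irreflexive, and every [F \subset E] is again a simple
   graph, namely a spanning subgraph of [E]. *)
Definition simple_graph (T : finType) (E : {set {set T}}) : bool :=
  [forall e in E, #|e| == 2].

Definition adj (T : finType) (E : {set {set T}}) : rel T :=
  fun x y => [set x; y] \in E.

Definition regular (T : finType) (E : {set {set T}}) (d : nat) : bool :=
  [forall x, #|[set y | adj E x y]| == d].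

Definition ext_nbhd (T : finType) (E : {set {set T}}) (S : {set T}) : {set T} :=
  [set y | (y \notin S) && [exists x in S, adj E x y]].

Definition induced (T : finType) (E : {set {set T}}) (S : {set T}) :
    {set {set T}} :=
  [set e in E | e \subset S].

(* [S] is the vertex set of the graph [induced E S]; [connect] is the
   reflexive-transitive closure. *)
Definition connected_on (T : finType) (E : {set {set T}}) (S : {set T}) : bool :=
  [forall x in S, forall y in S, connect (adj (induced E S)) x y].

Definition components (T : finType) (E : {set {set T}}) : {set {set T}} :=
  [set [set y | connect (adj E) x y] | x : T].

Definition largest_component (T : finType) (E : {set {set T}}) (L : {set T}) :
    bool :=
  (L \in components E) && [forall C in components E, #|C| <= #|L|]%N.

Definition adj_mx (R : realType) (n : nat) (E : {set {set 'I_n}}) : 'M[R]_n :=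
  \matrix_(i, j) (adj E i j)%:R.

(* [s] lists the eigenvalues of [A] with multiplicity, in nonincreasing order,
   so that [s`_i] is the (i+1)-st largest one. *)
Definition ordered_spectrum (R : realType) (n : nat) (A : 'M[R]_n) (s : seq R) :
    Prop :=
  sorted (fun x y : R => y <= x) s /\
  char_poly A = \prod_(x <- s) ('X - x%:P).

Definition ndl_graph (R : realType) (n d : nat) (lam : R)
    (E : {set {set 'I_n}}) : Prop :=
  [/\ simple_graph E, regular E d &
      exists s : seq R,
        [/\ ordered_spectrum (adj_mx R E) s,
            s`_0 = d%:R &
            lam = Num.max `|s`_1| `|s`_(n.-1)| ]].

(* Probability that the random subgraph of [E], in which each edge is retained
   independently with probability [p], satisfies [A]. *)
Definition perc_prob (R : realType) (T : finType) (E : {set {set T}}) (p : R)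
    (A : {set {set T}} -> Prop) : R :=
  \sum_(F in powerset E | `[< A F >]) p ^+ #|F| * (1 - p) ^+ #|E :\: F|.

(* Main.v *)
Require Import Defs.
From HB Require Import structures.
From mathcomp Require Import all_boot all_order all_algebra.
From mathcomp Require Import all_classical all_reals all_analysis.
From mathcomp Require Import complex spectral zify ring lra.

(** The idea is to explore a vertex set [S] from a set of roots, and to show
    that a set [S] of small boundary has to be found by an exploration whose
    numbers of queries and of positive answers are incompatible with an edge
    probability of [(1 + eps) / d].

    The exploration processes the vertices one by one. Processing [v] queries
    all edges from [v] to the vertices that are not yet known; every vertex so
    reached is either kept (it belongs to [S]) or discarded (it belongs to the
    boundary of [S]). Since [S] is not known in advance, one sums over all ways
    to split the reached vertices, with a factor [z] per kept vertex, [y] per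
    discarded one, and the normalisation [1 + p (z + y - 1)] to the power minus
    one per query. This [explore] weight has expectation exactly one
    ([expect_explore]), whatever the roots are, because each edge is queried at
    most once. On the other hand it is at least the single term that follows
    [S] ([explore_ge]). So each family of sets whose term is large is unlikely,
    by Markov's inequality, and the choices of roots are paid for by a union
    bound.

    The number of queries is controlled by the expander mixing lemma
    ([expander_mixing], from the spectral theorem): the exploration of a set of
    [k] vertices with a boundary of [m] vertices queries nearly
    [d k (1 - k / n)] edges at least, of which only [k + m] answer positively.

    - If [S] is connected and [k <= eps^2 n / 50], there is one root, the loss
      [k / n] is negligible against [eps], and with [z = 1 - eps / 2] the weight
      is at least [exp (eps^2 k / 8) >= n^2] ([connected_exponent]), whereas the
      sum over the [n] roots has expectation [n].
    - If [S] has linear size, up to [12 eps n / 11], the bound [d k (1 - k / n)]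
      is too weak since [k / n] may exceed [eps]. It ignores the edges inside
      [S] that are queried too. The first half of the processed vertices queries
      nearly all edges that leave the vertices discovered at that time, which
      replaces [k / n] by [3 k / (4 n)], provided that not many more vertices
      have been discovered than processed. A smaller value of [1 - z] during the
      first half makes the estimate independent of that number of vertices
      ([subset_exponent]).
    - In the second case the roots are one vertex of [S] and the vertices of [S]
      with a neighbour in the boundary [N] of [S]. As [S] lies in a component,
      all of [S] is reached from them ([boundary_spreads]). Their number is at
      most one plus the number of retained edges that meet [N]. A third weight,
      the sum over [M] of [eps^(6 |M|) 2^X(M)] with [X(M)] the number of
      retained edges that meet [M], shows that [X(N)] is of order
      [eps^2 k / ln (1 / eps)] at most when [|N|] is smaller by a further factor
      [ln (1 / eps)]; this accounts for the squared logarithm. The roots are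
      then so few that choosing them costs less than the weight gains.

    The failure probability is at most a constant that depends on [eps] only,
    divided by [n] ([vertex_expansion_prob]). *)

Set Implicit Arguments.
Unset Strict Implicit.
Unset Printing Implicit Defensive.

Import Order.TTheory GRing.Theory Num.Theory Num.Def.
Import numFieldNormedType.Exports.
Import mathcomp.boot.fintype mathcomp.boot.finset.

Local Open Scope ring_scope.

(** * The spectrum and the expander mixing lemma *)

Section Spectral.
Variable C : numClosedFieldType.
Local Notation "M ^t*" := (map_mx Num.conj M^T) (at level 30).

Lemma mx_sqnormE n (x : 'rV[C]_n) :
  (x *m x ^t*) 0 0 = \sum_i `|x 0 i| ^+ 2.
Proof. by rewrite mxE; apply: eq_bigr => i _; rewrite !mxE normCK. Qed.

(** In an orthonormal eigenbasis, [u] is supported on the only coordinate with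
    eigenvalue [d], since all other eigenvalues are smaller than [d] in absolute
    value; a vector orthogonal to [u] has no such coordinate. *)
Lemma normal_contraction n (A : 'M[C]_n) (s : seq C) (d lam : C)
    (u x : 'rV[C]_n) :
  A \is normalmx -> char_poly A = \prod_(a <- d :: s) ('X - a%:P) ->
  {in s, forall a, `|a| <= lam} -> lam < `|d| ->
  u != 0 -> u *m A = d *: u -> x *m u ^t* = 0 ->
  \sum_i `|(x *m A) 0 i| ^+ 2 <= lam ^+ 2 * \sum_i `|x 0 i| ^+ 2.
Proof.
move=> nA chA sle lamd u0 uA xu.
(* [P] and [sp] are abstracted from [A] so that [A] can be rewritten. *)
have [P [sp [Pun defA]]] : exists P : 'M[C]_n, exists sp : 'rV[C]_n,
    P \is unitarymx /\ A = invmx P *m diag_mx sp *m P.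
  exists (spectralmx A), (spectral_diag A).
  by split; [exact: spectral_unitarymx | exact/orthomx_spectralP].
have Punit : P \in unitmx := unitarymx_unit Pun.
have PV : invmx P = P ^t* := invmx_unitary Pun.
have ch : char_poly A = \prod_(i < n) ('X - (sp 0 i)%:P).
  transitivity (char_poly (diag_mx sp)).
    set cD := char_poly (diag_mx sp); rewrite /char_poly /char_poly_mx.
    pose Q := map_mx polyC P.
    have mapinv : map_mx polyC (invmx P) *m Q = 1%:M.
      by rewrite -map_mxM mulVmx // map_mx1.
    rewrite {1}defA !map_mxM /= -/Q.
    have -> : 'X%:M = map_mx polyC (invmx P) *m 'X%:M *m Q :> 'M[{poly C}]_n.
      by rewrite scalar_mxC -mulmxA mapinv mulmx1.
    rewrite -mulmxBl -mulmxBr !det_mulmx mulrAC -det_mulmx mapinv det1 mul1r //.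
  rewrite char_poly_trig; last first.
    by apply/is_trig_mxP => i j; rewrite mxE -val_eqE => /ltn_eqF ->.
  by apply: eq_bigr => i _; rewrite mxE eqxx mulr1n.
have PP : map_mx conjC (P ^t*)^T = P.
  by apply/matrixP => i j; rewrite !mxE conjCK.
have normP (z : 'rV[C]_n) :
    \sum_i `|(z *m P ^t*) 0 i| ^+ 2 = \sum_i `|z 0 i| ^+ 2.
  rewrite -!mx_sqnormE trmx_mul map_mxM PP mulmxA.
  by rewrite -(mulmxA z) -PV mulVmx // mulmx1.
pose ev := [seq sp 0 i | i <- enum 'I_n].
have evs : perm_eq ev (d :: s).
  by apply: prod_XsubC_eq; rewrite -chA ch /ev big_map big_enum.
pose v := u *m P ^t*; pose y := x *m P ^t*.
have spA : A *m P ^t* = P ^t* *m diag_mx sp.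
  by rewrite defA PV -!mulmxA -PV mulmxV // mulmx1.
have vE i : v 0 i * sp 0 i = d * v 0 i.
  have := congr1 (fun M => (M *m P ^t*) 0 i) uA.
  by rewrite -mulmxA spA mulmxA mul_mx_diag -scalemxAl !mxE.
have [i0 vi0] : exists i, v 0 i != 0.
  apply/existsP; apply: contraNT u0 => /existsPn v0.
  have {}v0 : v = 0 by apply/rowP => i; have /negPn/eqP -> := v0 i; rewrite mxE.
  by rewrite -(mulmx1 u) -(mulVmx Punit) PV mulmxA -/v v0 mul0mx.
have spi0 : sp 0 i0 = d by apply: (mulfI vi0); rewrite vE mulrC.
have spN i : i != i0 -> `|sp 0 i| <= lam.
  move=> ii0; apply: sle.
  have ienum : i \in rem i0 (enum 'I_n).
    by rewrite mem_rem_uniq ?enum_uniq // !inE ii0 mem_enum.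
  have : perm_eq (map (sp 0) (rem i0 (enum 'I_n))) s.
    rewrite -(perm_cons d) -[X in X :: _]spi0 -map_cons -(permPr evs) perm_sym.
    by apply/perm_map/perm_to_rem; rewrite mem_enum.
  by move=> /perm_mem <-; apply: map_f.
have yi0 : y 0 i0 = 0.
  have yv : y *m v ^t* = 0.
    rewrite /y /v trmx_mul map_mxM PP mulmxA.
    by rewrite -(mulmxA x) -PV mulVmx // mulmx1.
  have vT i : (v ^t*) i 0 = (v 0 i)^* by rewrite mxE mxE.
  have := congr1 (fun M : 'M[C]_1 => M 0 0) yv.
  rewrite [LHS]mxE [RHS]mxE (bigD1 i0) //= big1.
    by rewrite addr0 vT => /eqP; rewrite mulf_eq0 conjC_eq0 (negPf vi0) orbF => /eqP.
  move=> i ii0; rewrite vT.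
  suff -> : v 0 i = 0 by rewrite conjC0 mulr0.
  apply/eqP; apply: contraTT (spN i ii0) => vi.
  have -> : sp 0 i = d by apply: (mulfI vi); rewrite vE mulrC.
  by apply/negP => /(lt_le_trans lamd); rewrite ltxx.
rewrite -(normP (x *m A)) -(normP x) -/y mulr_sumr.
have -> : x *m A *m P ^t* = y *m diag_mx sp by rewrite -mulmxA spA mulmxA.
apply: ler_sum => i _; rewrite mul_mx_diag mxE normrM exprMn mulrC.
have [->|ii0] := eqVneq i i0; first by rewrite yi0 normr0 expr0n !mulr0.
by rewrite ler_wpM2r ?exprn_ge0 // lerXn2r ?nnegrE ?(le_trans _ (spN i ii0)) ?spN.
Qed.
End Spectral.

Lemma adj_sym (T : finType) (E : {set {set T}}) : symmetric (adj E).
Proof. by move=> x y; rewrite /adj setUC. Qed.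

Section Mixing.
Variables (R : realType) (n d : nat) (lam mu : R) (E : {set {set 'I_n}}).
Hypotheses (ndl : ndl_graph d lam E) (lam_mu : lam <= mu) (mu_gt0 : 0 < mu)
  (mu_d : mu < d%:R).

Let A := adj_mx R E.

(** The spectral theorem lives over an algebraically closed field, so the real
    symmetric matrix is moved to the complex numbers and back. *)
Lemma adj_mx_contraction (x : 'rV[R]_n) : \sum_i x 0 i = 0 ->
  \sum_i (x *m A) 0 i ^+ 2 <= mu ^+ 2 * \sum_i x 0 i ^+ 2.
Proof.
move=> x0; have [gE rE [s [[ss chs] s0 lamE]]] := ndl.
case: (posnP n) => [n0|n_gt0].
  by rewrite !big1 ?mulr0 // => -[i Hi]; exfalso; rewrite n0 in Hi.
have size_s : size s = n.
  by have := size_char_poly A; rewrite chs size_prod_XsubC => -[].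
pose AC := map_mx (real_complex R) A.
have nAC : AC \is normalmx.
  apply: symmetric_normalmx.
    by apply/is_hermitianmxP; rewrite expr0 scale1r; apply/matrixP => i j; rewrite !mxE adj_sym.
  by apply/mxOverP => i j; rewrite !mxE; apply/complex_realP; eexists.
have chC : char_poly AC = \prod_(a <- d%:R :: map (real_complex R) (behead s)) ('X - a%:P).
  rewrite -map_char_poly chs map_prod_XsubC -(big_map (real_complex R) xpredT (fun x => 'X - x%:P)).
  case: (s) size_s s0 => [/= n0|a s' _ /= ->]; first by rewrite -n0 in n_gt0.
  by rewrite /= rmorph_nat.
have smu : {in map (real_complex R) (behead s), forall a, `|a| <= (real_complex R) mu}.
  move=> _ /mapP[a sa ->].
  have [i isz <-] := nthP 0 sa; rewrite nth_behead.
  have i1n : (i.+1 < n)%N by move: isz; rewrite size_behead size_s; lia.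
  have ge_tr : transitive (fun x y : R => y <= x).
    by move=> a2 a1 a3 h12 h23; apply: le_trans h23 h12.
  have hom := sorted_leq_nth ge_tr (fun x => lexx x) 0 ss.
  have h1 : s`_i.+1 <= s`_1 by apply: hom; rewrite ?inE ?size_s // (leq_trans _ i1n).
  have h2 : s`_n.-1 <= s`_i.+1.
    by apply: hom; rewrite ?inE ?size_s ?prednK // -ltnS prednK.
  rewrite normc_def /= expr0n addr0 sqrtr_sqr lecR (le_trans _ lam_mu) // lamE.
  rewrite le_max !ler_norml; case: (lerP 0 s`_i.+1) => hs; apply/orP.
    left; rewrite !ger0_norm ?(le_trans hs) //.
    by rewrite h1 andbT (le_trans _ hs) // oppr_le0 (le_trans hs).
  right; rewrite (ltr0_norm (le_lt_trans h2 hs)) opprK h2 /=.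
  by rewrite (le_trans (ltW hs)) // oppr_ge0 (le_trans h2) ?ltW.
pose xC := map_mx (real_complex R) x.
have u0 : const_mx 1 != 0 :> 'rV[R[i]]_n.
  apply/eqP => /rowP/(_ (Ordinal n_gt0)); rewrite !mxE; exact/eqP/oner_neq0.
have uA : const_mx 1 *m AC = d%:R *: const_mx 1 :> 'rV[R[i]]_n.
  apply/rowP => j; rewrite !mxE mulr1.
  have /forallP/(_ j)/eqP <- := rE.
  rewrite -sum1_card natr_sum [RHS]big_mkcond /=; apply: eq_bigr => i _.
  by rewrite !mxE mul1r inE adj_sym rmorph_nat; case: adj.
have xu : xC *m map_mx Num.conj (const_mx 1 : 'rV_n)^T = 0.
  apply/rowP => j; rewrite !mxE.
  rewrite (eq_bigr (fun i => (real_complex R) (x 0 i))).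
    by rewrite -rmorph_sum x0 rmorph0.
  by move=> i _; rewrite !mxE conjC1 mulr1.
have mud : (real_complex R) mu < `|d%:R|.
  by rewrite normr_nat -(rmorph_nat (real_complex R)) ltcR.
have := normal_contraction nAC chC smu mud u0 uA xu.
have toCn (a : R) : `|(real_complex R) a| ^+ 2 = (real_complex R) (a ^+ 2).
  by rewrite normc_def /= expr0n addr0 sqrtr_sqr -rmorphXn real_normK ?num_real.
rewrite (eq_bigr (fun i => (real_complex R) ((x *m A) 0 i ^+ 2))); last first.
  by move=> i _; rewrite -map_mxM mxE toCn.
rewrite [X in _ <= _ * X -> _](eq_bigr (fun i => (real_complex R) (x 0 i ^+ 2))); last first.
  by move=> i _; rewrite mxE toCn.
by rewrite -!rmorph_sum -rmorphXn -rmorphM lecR.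
Qed.

(** With [x] the projection of the indicator of [X] orthogonally to the
    constants, the deviation is the sum over [Y] of the entries of [x *m A].
    Replacing the Cauchy-Schwarz inequality by [f <= f^2 / (2 mu) + mu / 2] on
    each entry gives the arithmetic mean of the two cardinals in the error term
    and avoids square roots. *)
Lemma expander_mixing (X Y : {set 'I_n}) :
  \sum_(v in X) #|[set y in Y | adj E v y]|%:R
    <= d%:R * #|X|%:R * #|Y|%:R / n%:R + mu * (#|X|%:R + #|Y|%:R) / 2 :> R.
Proof.
have [gE rE _] := ndl.
case: (posnP n) => [n0|n_gt0].
  have X0 : X = set0 by apply/setP => -[i Hi]; exfalso; rewrite n0 in Hi.
  rewrite {1}X0 big_set0 addr_ge0 ?divr_ge0 ?mulr_ge0 ?addr_ge0 ?ler0n //.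
  exact: ltW.
have n0 : n%:R != 0 :> R by rewrite pnatr_eq0 -lt0n.
pose x : 'rV[R]_n := \row_i ((i \in X)%:R - #|X|%:R / n%:R).
have sX : \sum_i (i \in X)%:R = #|X|%:R :> R.
  by rewrite -sum1_card natr_sum [RHS]big_mkcond /=; apply: eq_bigr => i _; case: ifP.
have x0 : \sum_i x 0 i = 0.
  under eq_bigr do rewrite mxE.
  by rewrite sumrB sX sumr_const card_ord -[X in _ - X]mulr_natr divfK ?subrr.
have xx : \sum_i x 0 i ^+ 2 <= #|X|%:R.
  have -> : \sum_i x 0 i ^+ 2 = \sum_i ((i \in X)%:R * x 0 i) - #|X|%:R / n%:R * \sum_i x 0 i.
    rewrite mulr_sumr -sumrB; apply: eq_bigr => i _; rewrite mxE; ring.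
  rewrite x0 mulr0 subr0 -sX; apply: ler_sum => i _; rewrite mxE.
  case: (i \in X); rewrite ?mul1r ?mul0r // gerBl divr_ge0 ?ler0n //.
have := adj_mx_contraction x0; set f := x *m A => fx.
have fy : \sum_(y in Y) f 0 y <= mu * (#|X|%:R + #|Y|%:R) / 2.
  apply: (@le_trans _ _ (\sum_(y in Y) (f 0 y ^+ 2 / (2 * mu) + mu / 2))).
    apply: ler_sum => y _; rewrite -subr_ge0.
    have -> : f 0 y ^+ 2 / (2 * mu) + mu / 2 - f 0 y = (f 0 y - mu) ^+ 2 / (2 * mu).
      by field; rewrite gt_eqF.
    by rewrite divr_ge0 ?sqr_ge0 // mulr_ge0 // ltW.
  rewrite big_split /= sumr_const -mulr_suml.
  have fs : \sum_(y in Y) f 0 y ^+ 2 <= mu ^+ 2 * #|X|%:R.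
    apply: le_trans (le_trans fx _); last by rewrite ler_wpM2l ?sqr_ge0.
    rewrite [leRHS](bigID [in Y]) /= lerDl; apply: sumr_ge0 => i _; exact: sqr_ge0.
  have -> : mu * (#|X|%:R + #|Y|%:R) / 2 = (mu ^+ 2 * #|X|%:R) / (2 * mu) + (mu / 2) *+ #|Y|.
    by rewrite -[X in _ = _ + X]mulr_natr; field; rewrite gt_eqF.
  by rewrite lerD2r ler_wpM2r // invr_ge0 mulr_ge0 // ltW.
suff -> : \sum_(v in X) #|[set y in Y | adj E v y]|%:R
    = d%:R * #|X|%:R * #|Y|%:R / n%:R + \sum_(y in Y) f 0 y.
  by rewrite lerD2l.
have fE y : f 0 y = \sum_(v in X) (adj E v y)%:R - #|X|%:R / n%:R * d%:R.
  have -> : d%:R = \sum_i (adj E y i)%:R :> R.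
    have /forallP/(_ y)/eqP <- := rE; rewrite -sum1_card natr_sum big_mkcond.
    by apply: eq_bigr => i _; rewrite inE; case: adj.
  rewrite mxE mulr_sumr [X in X - _]big_mkcond -sumrB; apply: eq_bigr => i _.
  rewrite !mxE (adj_sym E y); case: (i \in X); case: (adj E i y) => /=; ring.
under [X in _ = _ + X]eq_bigr do rewrite fE.
rewrite sumrB sumr_const -[X in _ - X]mulr_natr exchange_big /=.
have -> : \sum_(v in X) \sum_(y in Y) (adj E v y)%:R
    = \sum_(v in X) #|[set y in Y | adj E v y]|%:R :> R.
  apply: eq_bigr => v _; rewrite -sum1_card natr_sum big_mkcond [RHS]big_mkcond.
  by apply: eq_bigr => y _; rewrite inE; case: (y \in Y); case: (adj E v y).
ring.
Qed.

End Mixing.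

(** * Product measure on edge sets and the exploration weight *)

Section Expectation.
Variables (R : realType) (p : R).

(** The mean of [f] over the random subset of [X] that keeps each element
    independently with probability [p]. *)
Definition expect (I : finType) (X : {set I}) (f : {set I} -> R) : R :=
  \sum_(F in powerset X) p ^+ #|F| * (1 - p) ^+ #|X :\: F| * f F.

Lemma sum_powerset (I : finType) (X : {set I}) (a b : R) :
  \sum_(F in powerset X) a ^+ #|F| * b ^+ #|X :\: F| = (a + b) ^+ #|X|.
Proof.
transitivity (\prod_i ((if i \in X then a else 0) + (if i \in X then b else 1))).
  rewrite bigA_distr /= [RHS](bigID [in powerset X]) /= [X in _ + X]big1 ?addr0.
    apply: eq_bigr => F.
    rewrite powersetE => FX.
    rewrite -(setIidPr FX) -prodr_const -[in X in _ * X]prodr_const.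
    rewrite [X in X * _]big_mkcond [X in _ * X]big_mkcond -big_split /=.
    apply: eq_bigr => i _; rewrite !inE.
    by case: (i \in X) => //=; case: (i \in F); rewrite ?mul1r ?mulr1.
  move=> F; rewrite powersetE => /subsetPn[i iF iX].
  by rewrite (bigD1 i) //= iF (negPf iX) mul0r.
rewrite -prodr_const [RHS]big_mkcond; apply: eq_bigr => i _.
by case: ifP; rewrite ?add0r.
Qed.

Lemma expect_const (I : finType) (X : {set I}) (c : R) : expect X (fun=> c) = c.
Proof. by rewrite /expect -mulr_suml sum_powerset subrKC expr1n mul1r. Qed.

Lemma eq_expect (I : finType) (X : {set I}) (f g : {set I} -> R) :
  (forall F : {set I}, F \subset X -> f F = g F) -> expect X f = expect X g.
Proof. by move=> fg; apply: eq_bigr => F; rewrite powersetE => /fg ->. Qed.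

(** Independence of the random subset inside disjoint sets. *)
Lemma expect_split (I : finType) (Y Z : {set I}) (f : {set I} -> R) :
  [disjoint Y & Z] ->
  expect (Y :|: Z) f = expect Y (fun F => expect Z (fun F' => f (F :|: F'))).
Proof.
move=> dYZ; rewrite /expect.
under [RHS]eq_bigr do rewrite mulr_sumr.
rewrite pair_big_dep /=.
rewrite (reindex_onto (fun u : {set I} * {set I} => u.1 :|: u.2)
  (fun F => (F :&: Y, F :&: Z))); last first.
  by move=> F; rewrite powersetE /= -setIUr => /setIidPl.
have dis (A B : {set I}) : A \subset Y -> B \subset Z -> [disjoint A & B].
  by move=> AY BZ; apply: disjointWl AY (disjointWr BZ dYZ).
apply: eq_big => -[A B] /=; last first.
  move=> /andP[]; rewrite powersetE => ABYZ /eqP[AE BE].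
  have AY : A \subset Y by rewrite -AE subsetIr.
  have BZ : B \subset Z by rewrite -BE subsetIr.
  have -> : #|A :|: B| = (#|A| + #|B|)%N.
    by apply/eqP; rewrite (leq_card_setU A B).2 dis.
  have -> : (Y :|: Z) :\: (A :|: B) = (Y :\: A) :|: (Z :\: B).
    apply/setP => i; rewrite !inE.
    have := disjointFr dYZ (x := i); have := disjointFl dYZ (x := i).
    have := subsetP AY i; have := subsetP BZ i.
    case: (i \in A); case: (i \in B); case: (i \in Y); case: (i \in Z) => //=; intuition.
  have -> : #|(Y :\: A) :|: (Z :\: B)| = (#|Y :\: A| + #|Z :\: B|)%N.
    by apply/eqP; rewrite (leq_card_setU _ _).2 dis ?subsetDl.
  by rewrite !exprD; ring.
rewrite !powersetE; apply/andP/andP => [[sAB /eqP[AE BE]]|[AY BZ]].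
  by split; [rewrite -AE subsetIr | rewrite -BE subsetIr].
split; first exact: setUSS.
have AZ : A :&: Z = set0 by apply: disjoint_setI0; apply: disjointWl AY dYZ.
have BY : B :&: Y = set0.
  by apply: disjoint_setI0; apply: disjointWl BZ _; rewrite disjoint_sym.
by rewrite !setIUl AZ BY setU0 set0U (setIidPl AY) (setIidPl BZ).
Qed.

(** A function of the part of the random set that is seen through an injection
    [h] has the mean of a random subset of the source of [h]; it turns the
    random edges at a vertex into random neighbours. *)
Lemma expect_preimset (I J : finType) (h : J -> I) (Q : {set J}) (X : {set I})
    (g : {set J} -> R) :
  {in Q &, injective h} -> h @: Q \subset X ->
  expect X (fun F => g [set u in Q | h u \in F]) = expect Q g.
Proof.
move=> hinj hQX; have XE : X = h @: Q :|: (X :\: h @: Q) by rewrite setDE setUIr setUCr setIT (setUidPr hQX).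
rewrite {1}XE expect_split; last by rewrite disjoints_subset setCD subsetU ?subxx ?orbT.
transitivity (expect (h @: Q) (fun F => g [set u in Q | h u \in F])).
  apply: eq_expect => F FQ; rewrite -[RHS](expect_const (X :\: h @: Q)).
  apply: eq_expect => F' /subsetP F'X; congr g; apply/setP => u; rewrite !inE.
  case: (boolP (u \in Q)) => //= uQ; case: (boolP (h u \in F')); last by rewrite orbF.
  by move=> /F'X; rewrite inE imset_f.
rewrite /expect (reindex_onto (fun B : {set J} => h @: B) (fun F => [set u in Q | h u \in F])); last first.
  move=> F; rewrite powersetE => /subsetP FQ; apply/setP => i.
  apply/imsetP/idP => [[u]|iF]; first by rewrite inE => /andP[_ ?] ->.
  by have /imsetP[u uQ iE] := FQ _ iF; exists u; rewrite // inE uQ -iE.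
have pre (B : {set J}) : B \subset Q -> [set u in Q | h u \in h @: B] = B.
  move=> BQ; apply/setP => u; rewrite inE; apply/andP/idP => [[uQ /imsetP[w wB hE]]|uB].
    by rewrite (hinj _ _ uQ (subsetP BQ _ wB) hE).
  by rewrite (subsetP BQ) ?imset_f.
apply: eq_big => B.
  rewrite !powersetE; apply/andP/idP => [[_ /eqP <-]|BQ].
    by apply/subsetP => u; rewrite inE => /andP[].
  by rewrite imsetS // pre.
move=> /andP[_ /eqP BE].
have BQ : B \subset Q by rewrite -BE; apply/subsetP => u; rewrite inE => /andP[].
rewrite pre // card_in_imset; last by move=> u w uB wB; apply: hinj; apply: (subsetP BQ).
have -> : h @: Q :\: h @: B = h @: (Q :\: B).
  apply/setP => i; rewrite inE; apply/andP/imsetP => [[iB /imsetP[u uQ iE]]|[u]].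
    by exists u => //; rewrite inE uQ andbT; apply: contra iB => uB; rewrite iE imset_f.
  rewrite inE => /andP[uB uQ ->]; split; last exact: imset_f.
  apply: contra uB => /imsetP[w wB hE].
  by rewrite (hinj _ _ uQ (subsetP BQ _ wB) hE).
rewrite card_in_imset //; move=> u w /setDP[uQ _] /setDP[wQ _]; exact: hinj.
Qed.

Lemma expect_sum_powerset (J : finType) (Q : {set J}) (z y : R) :
  expect Q (fun N => \sum_(B in powerset N) z ^+ #|B| * y ^+ #|N :\: B|)
  = (1 + p * (z + y - 1)) ^+ #|Q|.
Proof.
have -> : 1 + p * (z + y - 1) = p * (z + y) + (1 - p) by ring.
rewrite -sum_powerset; apply: eq_bigr => N _.
by rewrite sum_powerset exprMn; ring.
Qed.

Lemma expect_sum (I J : finType) (X : {set I}) (r : {pred J}) (f : J -> {set I} -> R) :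
  expect X (fun F => \sum_(j in r) f j F) = \sum_(j in r) expect X (f j).
Proof. by rewrite /expect exchange_big; apply: eq_bigr => F _; rewrite mulr_sumr. Qed.

Lemma expectZ (I : finType) (X : {set I}) (c : R) (f : {set I} -> R) :
  expect X (fun F => c * f F) = c * expect X f.
Proof. by rewrite /expect mulr_sumr; apply: eq_bigr => F _; ring. Qed.

Lemma expectD (I : finType) (X : {set I}) (f g : {set I} -> R) :
  expect X (fun F => f F + g F) = expect X f + expect X g.
Proof. by rewrite /expect -big_split; apply: eq_bigr => F _; rewrite mulrDr. Qed.

End Expectation.

Lemma subn_split (a b m e : nat) : m = (a + b)%N -> (m <= e)%N ->
  (e - a = b + (e - m))%N.
Proof. lia. Qed.

Section Exploration.
Variables (R : realType) (T : finType) (E : {set {set T}}) (p y : R).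

(* Vertices already processed, vertices found to be in the explored set, and
   vertices found to be on its boundary. The processed vertices are among the
   discovered ones. *)
Local Notation state := ({set T} * {set T} * {set T})%type.
Definition processed (st : state) := st.1.1.
Definition discovered (st : state) := st.1.2.
Definition dead (st : state) := st.2.

Definition fresh (st : state) (v : T) : {set T} :=
  [set u | adj E v u] :\: (discovered st :|: dead st).

Definition hits (F : {set {set T}}) (st : state) (v : T) : {set T} :=
  [set u in fresh st v | adj F v u].

Definition advance (st : state) (v : T) (B N : {set T}) : state :=
  (v |: processed st, discovered st :|: B, dead st :|: (N :\: B)).

(** The mean factor contributed by the answer to one query: [1] if it is
    negative, and [z] or [y], both being counted, if it is positive. *)
Definition gain (z : R) : R := 1 + p * (z + y - 1).

(** The list [zs] gives one weight per processed vertex; varying weights are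
    needed for the sets of linear size. *)
Fixpoint explore (zs : seq R) (st : state) (F : {set {set T}}) : R :=
  if zs is z :: zs' then
    if [pick v in discovered st :\: processed st] is Some v then
      let N := hits F st v in
      gain z ^- #|fresh st v| *
      \sum_(B in powerset N) z ^+ #|B| * y ^+ #|N :\: B|
        * explore zs' (advance st v B N) F
    else 1
  else 1.

(** The edges that the exploration has not looked at once [P] is processed. *)
Definition away (P : {set T}) : {set {set T}} := [set e in E | [disjoint e & P]].

Lemma advance_processed_sub (st : state) (v : T) (B N : {set T}) :
  processed st \subset discovered st -> v \in discovered st ->
  processed (advance st v B N) \subset discovered (advance st v B N).
Proof.
by move=> sPD vD; rewrite /= subUset sub1set inE vD /= (subset_trans sPD) ?subsetUl.
Qed.

Lemma explore_local (zs : seq R) (st : state) (F F' : {set {set T}}) :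
  processed st \subset discovered st ->
  (forall e : {set T}, [disjoint e & processed st] -> (e \in F) = (e \in F')) ->
  explore zs st F = explore zs st F'.
Proof.
elim: zs st => //= z zs IHzs st sPD FF'; case: pickP => // v /setDP[vD vP].
have hitsE : hits F st v = hits F' st v.
  apply/setP => u; rewrite !inE; case: (boolP (u \in discovered st)) => //= uD.
  case: (u \in dead st) => //=; case: (adj E v u) => //=.
  apply: FF'; rewrite disjoints_subset subUset !sub1set !inE vP /=.
  by apply: contra uD => /(subsetP sPD).
rewrite hitsE; congr (_ * _); apply: eq_bigr => B _; congr (_ * _).
apply: IHzs; first exact: advance_processed_sub.
move=> e /= dis; apply: FF'; apply: disjointWr dis; exact: subsetUr.
Qed.

Lemma away_setU1 (P : {set T}) (v : T) (e : {set T}) :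
  (e \in away (v |: P)) = (e \in away P) && (v \notin e).
Proof.
rewrite !inE !disjoints_subset setCU subsetI -[e \subset ~: [set v]]disjoints_subset.
by rewrite disjoint_sym disjoints1 [X in _ && X]andbC andbA.
Qed.

(** By induction on the number of vertices to process. The edges at the next
    vertex [v] are independent of the edges away from [v] and the processed
    ones, on which alone the rest of the exploration depends
    ([explore_local]); whatever the split [B], the rest has mean one, and what
    remains is the normalised generating function of the answers at [v]. *)
Lemma expect_explore (zs : seq R) (st : state) : processed st \subset discovered st ->
  {in zs, forall z, gain z != 0} ->
  expect p (away (processed st)) (explore zs st) = 1.
Proof.
elim: zs st => [|z zs IHzs] st sPD zs0; first by rewrite [LHS]expect_const.
rewrite /=; case: pickP => [v /setDP[vD vP]|_]; last by rewrite expect_const.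
pose star := [set e in away (processed st) | v \in e].
have awayE : away (processed st) = star :|: away (v |: processed st).
  apply/setP => e; rewrite in_setU away_setU1 [e \in star]in_set.
  by case: (e \in away _); case: (v \in e).
have starD : [disjoint star & away (v |: processed st)].
  rewrite disjoints_subset; apply/subsetP => e.
  by rewrite in_set => /andP[_ ve]; rewrite in_setC away_setU1 ve andbF.
rewrite awayE expect_split //.
transitivity (expect p star (fun F => gain z ^- #|fresh st v| *
   \sum_(B in powerset (hits F st v)) z ^+ #|B| * y ^+ #|hits F st v :\: B|)).
  apply: eq_expect => F /subsetP Fstar.
  transitivity (expect p (away (v |: processed st)) (fun F' => gain z ^- #|fresh st v| *
      \sum_(B in powerset (hits F st v)) z ^+ #|B| * y ^+ #|hits F st v :\: B|
        * explore zs (advance st v B (hits F st v)) F')).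
    apply: eq_expect => F' /subsetP F'away.
    have -> : hits (F :|: F') st v = hits F st v.
      apply/setP => u; rewrite in_set [RHS]in_set /adj in_setU.
      case: (boolP ([set v; u] \in F')) => [/F'away|]; last by rewrite orbF.
      by rewrite away_setU1 !inE eqxx /= andbF.
    congr (_ * _); apply: eq_bigr => B _; congr (_ * _).
    apply: explore_local => [|e dis]; first exact: advance_processed_sub.
    rewrite in_setU; case: (boolP (e \in F)) => [/Fstar|//].
    rewrite in_set => /andP[_ ve]; move: dis.
    by rewrite disjoint_sym disjoints_subset /= subUset sub1set in_setC ve.
  rewrite expectZ expect_sum; congr (_ * _); apply: eq_bigr => B _.
  rewrite expectZ -[X in away X]/(processed (advance st v B (hits F st v))) IHzs ?mulr1 //.
    exact: advance_processed_sub.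
  by move=> z' z'zs; rewrite zs0 // inE z'zs orbT.
rewrite expectZ.
have := @expect_preimset _ p _ _ (fun u => [set v; u]) (fresh st v) star
  (fun N => \sum_(B in powerset N) z ^+ #|B| * y ^+ #|N :\: B|).
rewrite expect_sum_powerset => ->; first by rewrite mulVf // expf_neq0 ?zs0 ?mem_head.
  move=> u w; rewrite !inE => /andP[/norP[uD _] _] /andP[/norP[wD _] _] vuw.
  have : u \in [set v; w] by rewrite -vuw !inE eqxx orbT.
  rewrite !inE => /orP[/eqP uv|/eqP //]; by rewrite uv vD in uD.
apply/subsetP => _ /imsetP[u uf ->]; move: uf; rewrite !inE => /andP[/norP[uD _] vu].
rewrite eqxx /= andbT -/(adj E v u) vu /= disjoints_subset subUset !sub1set !inE vP /=.
by apply: contra uD => /(subsetP sPD).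
Qed.

Lemma explore_ge0 (zs : seq R) (st : state) (F : {set {set T}}) :
  0 <= y -> {in zs, forall z, 0 <= z /\ 0 < gain z} -> 0 <= explore zs st F.
Proof.
move=> y0; elim: zs st => //= z zs IHzs st zs0; case: pickP => // v _.
have [z0 g0] := zs0 z (mem_head _ _).
rewrite mulr_ge0 ?invr_ge0 ?exprn_ge0 ?(ltW g0) // sumr_ge0 // => B _.
rewrite !mulr_ge0 ?exprn_ge0 ?IHzs // => z' z'zs.
by apply: zs0; rewrite inE z'zs orbT.
Qed.

(** The choice of the split that keeps exactly the reached vertices of [S]. *)
Definition follow (F : {set {set T}}) (S : {set T}) (st : state) : state :=
  if [pick v in discovered st :\: processed st] is Some v
  then advance st v (hits F st v :&: S) (hits F st v) else st.

(** A lower bound for the number of queries between [st] and [st'], which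
    forgets those that were made towards vertices discovered later on. It
    depends on the two states only, and the expander mixing lemma applies
    to it. *)
Definition queries (st st' : state) : nat :=
  (\sum_(v in processed st' :\: processed st)
    #|[set u | adj E v u] :\: (discovered st' :|: dead st')|)%N.

Section Follow.
Variables (F : {set {set T}}) (S : {set T}).

Lemma follow_sub (st : state) : [/\ processed st \subset processed (follow F S st),
  discovered st \subset discovered (follow F S st) & dead st \subset dead (follow F S st)].
Proof. by rewrite /follow; case: pickP => [v _|_] //=; rewrite subsetUr !subsetUl. Qed.

Lemma iter_follow_sub j (st : state) :
  [/\ processed st \subset processed (iter j (follow F S) st),
      discovered st \subset discovered (iter j (follow F S) st) &
      dead st \subset dead (iter j (follow F S) st)].
Proof.
elim: j => //= j [IHp IHd IHm]; have [p1 d1 m1] := follow_sub (iter j (follow F S) st).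
by rewrite (subset_trans IHp) // (subset_trans IHd) // (subset_trans IHm).
Qed.

(** Only the term that follows [S] is kept. Counting too few queries is harmless
    as long as [gain z <= 1]. *)
Lemma explore_ge j (z : R) (zs : seq R) (st : state) (st' := iter j (follow F S) st) :
  0 < z -> 0 < y -> 0 < gain z -> gain z <= 1 ->
  {in zs, forall z, 0 <= z /\ 0 < gain z} ->
  z ^+ (#|discovered st'| - #|discovered st|) * y ^+ (#|dead st'| - #|dead st|) *
    gain z ^- queries st st' * explore zs st' F
  <= explore (nseq j z ++ zs) st F.
Proof.
move=> z0 y0 g0 g1 zs0; rewrite {}/st'; elim: j st => [|j IHj] st.
  by rewrite /= /queries setDv big_set0 !subnn !expr0 invr1 !mul1r.
rewrite iterSr /= [follow F S st]/follow; case: pickP => [v /setDP[vD vP]|nov]; last first.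
  suff -> : iter j (follow F S) st = st.
    rewrite /queries setDv big_set0 !subnn !expr0 invr1 !mul1r.
    case: (zs) => //= z' zs'; case: pickP => // v; by rewrite nov.
  have fix1 : follow F S st = st by rewrite /follow; case: pickP => // v; rewrite nov.
  by elim: j {IHj} => //= j ->.
set N := hits F st v; set st1 := advance st v (N :&: S) N.
have [sp sd sm] := iter_follow_sub j st1.
move: (IHj st1) sp sd sm; set st' := iter j (follow F S) st1 => IH sp sd sm.
have NS B : N :&: S \in powerset N by rewrite powersetE subsetIl.
have cz : 0 <= y by apply: ltW.
apply: (@le_trans _ _ (gain z ^- #|fresh st v| * (z ^+ #|N :&: S| * y ^+ #|N :\: (N :&: S)|
    * explore (nseq j z ++ zs) st1 F))); last first.
  rewrite ler_wpM2l ?invr_ge0 ?exprn_ge0 ?(ltW g0) //.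
  rewrite (bigD1 (N :&: S)) //=; [apply: ler_wpDr; last exact: lexx | exact: NS].
  rewrite sumr_ge0 // => B _.
  rewrite !mulr_ge0 ?exprn_ge0 ?(ltW z0) // explore_ge0 // => z'.
  by rewrite mem_cat mem_nseq => /orP[/andP[_ /eqP ->]|/zs0 //]; rewrite ltW.
apply: (@le_trans _ _ (gain z ^- #|fresh st v| * (z ^+ #|N :&: S| * y ^+ #|N :\: (N :&: S)|
    * (z ^+ (#|discovered st'| - #|discovered st1|) * y ^+ (#|dead st'| - #|dead st1|) *
    gain z ^- queries st1 st' * explore zs st' F)))); last first.
  by rewrite !ler_wpM2l ?mulr_ge0 ?invr_ge0 ?exprn_ge0 ?(ltW g0) ?(ltW z0).
have hitsD (u : T) : u \in N -> (u \notin discovered st) && (u \notin dead st).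
  by rewrite !inE => /andP[/andP[/norP[-> ->]]].
have d1 : #|discovered st1| = (#|discovered st| + #|N :&: S|)%N.
  apply/eqP; rewrite (leq_card_setU _ _).2 disjoint_sym disjoints_subset.
  by apply/subsetP => u; rewrite in_setI in_setC => /andP[/hitsD/andP[]].
have m1 : #|dead st1| = (#|dead st| + #|N :\: (N :&: S)|)%N.
  apply/eqP; rewrite (leq_card_setU _ _).2 disjoint_sym disjoints_subset.
  by apply/subsetP => u; rewrite in_setD in_setC => /andP[_ /hitsD/andP[]].
have -> : (#|discovered st'| - #|discovered st| = #|N :&: S| + (#|discovered st'| - #|discovered st1|))%N.
  exact: subn_split d1 (subset_leq_card sd).
have -> : (#|dead st'| - #|dead st| = #|N :\: (N :&: S)| + (#|dead st'| - #|dead st1|))%N.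
  exact: subn_split m1 (subset_leq_card sm).
have q1 : (queries st st' <= #|fresh st v| + queries st1 st')%N.
  rewrite /queries (bigD1 v) /=; last first.
    by rewrite inE vP (subsetP sp) // !inE eqxx.
  apply: leq_add.
    apply: subset_leq_card; apply: setDS; apply: setUSS.
      by apply: subset_trans sd; apply: subsetUl.
    by apply: subset_trans sm; apply: subsetUl.
  apply: eq_leq; apply: eq_bigl => u; rewrite !inE negb_or.
  by case: (u \in processed st'); case: (u \in processed st); case: (u == v).
have ex0 : 0 <= explore zs st' F by apply: explore_ge0.
have ineq : gain z ^- queries st st' <= gain z ^- #|fresh st v| * gain z ^- queries st1 st'.
  by rewrite -invfM -exprD lef_pV2 ?posrE ?exprn_gt0 // ler_wiXn2l // ltW.
rewrite !exprD.
set a := z ^+ _; set b := z ^+ _; set c := y ^+ _; set e := y ^+ _.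
have -> : gain z ^- #|fresh st v| * (a * c * (b * e * gain z ^- queries st1 st' * explore zs st' F))
  = a * b * (c * e) * (gain z ^- #|fresh st v| * gain z ^- queries st1 st') * explore zs st' F by ring.
by rewrite ler_wpM2r // ler_wpM2l // !mulr_ge0 ?exprn_ge0 // ltW.
Qed.

(** Every vertex of [S] is joined to [rho] by a path of [F] inside [S], in the
    form of an induction principle. *)
Definition spreads (rho : {set T}) := forall D : {set T}, rho \subset D -> D \subset S ->
  {in D & S, forall x y, adj F x y -> y \in D} -> D = S.

Variable rho : {set T}.
Hypotheses (FE : F \subset E) (rhoS : rho \subset S).

Local Notation run j := (iter j (follow F S) (set0, rho, set0)).

Lemma run_inv j : [/\ processed (run j) \subset discovered (run j), rho \subset discovered (run j),
  discovered (run j) \subset S, dead (run j) \subset ext_nbhd F S &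
  {in processed (run j) & S, forall x y, adj F x y -> y \in discovered (run j)}].
Proof.
elim: j => [|j [pd rd dS dN cl]]; first by split; rewrite ?sub0set //= => x; rewrite inE.
rewrite iterS; move: (run j) pd rd dS dN cl => st pd rd dS dN cl.
rewrite /follow; case: pickP => [v /setDP[vD vP]|_] //.
have vS := subsetP dS _ vD.
split.
- exact: advance_processed_sub.
- exact: subset_trans rd (subsetUl _ _).
- by rewrite /= subUset dS subsetIr.
- rewrite /= subUset dN; apply/subsetP => u; rewrite in_setD in_setI.
  case: (boolP (u \in hits F st v)) => //=; rewrite inE => /andP[_ vu]; rewrite andbT => uS.
  by rewrite inE uS; apply/existsP; exists v; rewrite vS.
move=> x u; rewrite in_setU1 => /orP[/eqP ->|xP] uS xu; rewrite /= in_setU; last by rewrite (cl x u).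
case: (boolP (u \in discovered _)) => //= uD; rewrite !inE (negPf uD) uS xu /= !andbT.
apply/andP; split; last by apply: (subsetP FE).
by apply: contraL uS => /(subsetP dN); rewrite inE => /andP[].
Qed.

Hypothesis spr : spreads rho.

(** The exploration cannot stop early: when all discovered vertices are
    processed, they form a set closed under adjacency in [S]. *)
Lemma run_card j : (j <= #|S|)%N -> #|processed (run j)| = j.
Proof.
elim: j => [|j IHj] jS; first by rewrite cards0.
have [pd rd dS dN cl] := run_inv j.
rewrite iterS {1}/follow; case: pickP => [v /setDP[vD vP]|nov].
  by rewrite cardsU1 vP IHj ?(ltnW jS).
have dp : discovered (run j) \subset processed (run j).
  by apply/subsetP => v vD; have := nov v; rewrite inE vD andbT => /negbFE.
have DS : discovered (run j) = S.
  apply: spr => // x u xD uS; apply: cl => //; exact: (subsetP dp).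
by have := subset_leq_card dp; rewrite DS IHj ?(ltnW jS) // leqNgt jS.
Qed.

Lemma run_end : processed (run #|S|) = S /\ discovered (run #|S|) = S.
Proof.
have [pd rd dS dN cl] := run_inv #|S|.
have pS : processed (run #|S|) = S.
  apply/eqP; rewrite eqEcard run_card // leqnn andbT; exact: subset_trans pd dS.
split=> //; apply/eqP; rewrite eqEsubset dS /=.
by apply: subset_trans pd; rewrite pS.
Qed.

End Follow.
End Exploration.

(** * The exploration weight of an explored set in a pseudorandom graph *)

(** Squaring [1 + t / 2 <= exp (t / 2)] is precise enough for the coefficient one
    of [x^2]; the bound [1 + t <= exp t] itself only gives [- (x + 2 x^2)]. *)
Lemma expR_le_geom (R : realType) (x : R) : 0 <= x -> x <= 1 / 8 ->
  expR (- (x + x ^+ 2)) <= 1 - x.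
Proof.
move=> x0 x1; rewrite expRN -[leRHS]invrK lef_pV2 ?posrE ?expR_gt0 ?invr_gt0 ?subr_gt0 //; last lra.
have -> : expR (x + x ^+ 2) = expR ((x + x ^+ 2) / 2) ^+ 2.
  by rewrite -expRM_natl; congr expR; field.
have h := expR_ge1Dx ((x + x ^+ 2) / 2).
have x20 := sqr_ge0 x.
apply: (@le_trans _ _ ((1 + (x + x ^+ 2) / 2) ^+ 2)); last first.
  by rewrite lerXn2r ?nnegrE ?expR_ge0 //; lra.
rewrite -(@ler_pM2l _ (1 - x)); last lra.
rewrite mulfV; last by apply: lt0r_neq0; lra.
have -> : (1 - x) * (1 + (x + x ^+ 2) / 2) ^+ 2 =
  1 + x ^+ 2 / 4 * (1 - 3 * x - x ^+ 2 - x ^+ 3) by field.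
rewrite lerDl mulr_ge0 ?divr_ge0 //.
have : x ^+ 2 <= 1 / 8 * (1 / 8) by rewrite expr2 ler_pM.
have : x ^+ 3 <= 1 / 8 * x ^+ 2 by rewrite exprS ler_wpM2r.
lra.
Qed.

(* The second eigenvalue enters through the mixing inequality with
   [mu = eps^4 d] only. *)
Section PhaseBound.
Variables (R : realType) (n d : nat) (E : {set {set 'I_n}}) (eps y : R).
Hypotheses (d_gt0 : (0 < d)%N) (regE : regular E d) (eps_gt0 : 0 < eps).
Hypothesis mixing : forall X Y : {set 'I_n},
  \sum_(v in X) #|[set u in Y | adj E v u]|%:R
    <= d%:R * #|X|%:R * #|Y|%:R / n%:R
       + (eps ^+ 4 * d%:R) * (#|X|%:R + #|Y|%:R) / 2 :> R.

Local Notation p := ((1 + eps) / d%:R).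
Hypotheses (y_gt0 : 0 < y) (p_le1 : p <= 1).

Lemma gain_bounds (x : R) : y <= x -> x <= 1 / 8 ->
  [/\ 0 < gain p y (1 - x), gain p y (1 - x) <= 1 &
      gain p y (1 - x) <= expR (- (p * (x - y)))].
Proof.
move=> yx x2; have y0 := y_gt0; have p0 : 0 <= p by rewrite divr_ge0 ?ler0n // addr_ge0 // ltW.
have -> : gain p y (1 - x) = 1 - p * (x - y) by rewrite /gain; ring.
have pxy : p * (x - y) <= 1 / 2.
  apply: (@le_trans _ _ (1 * (x - y))); last by lra.
  by rewrite ler_wpM2r // subr_ge0.
have pxy0 : 0 <= p * (x - y) by rewrite mulr_ge0 // subr_ge0.
split; [by lra|by lra|exact: expR_ge1Dx].
Qed.

Lemma queries_ge (st st' : {set 'I_n} * {set 'I_n} * {set 'I_n}) (W : R)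
    (X := processed st' :\: processed st) :
  #|discovered st'|%:R + #|dead st'|%:R <= W ->
  d%:R * (#|X|%:R - #|X|%:R * W / n%:R - eps ^+ 4 * (#|X|%:R + W) / 2)
    <= (queries E st st')%:R.
Proof.
move=> hW; set Y := discovered st' :|: dead st'.
have YW : #|Y|%:R <= W.
  by apply: le_trans hW; rewrite -natrD ler_nat leq_card_setU.
have -> : (queries E st st')%:R
    = d%:R * #|X|%:R - \sum_(v in X) #|[set u in Y | adj E v u]|%:R :> R.
  rewrite /queries natr_sum; apply/eqP; rewrite eq_sym subr_eq -big_split /=; apply/eqP.
  rewrite mulr_natr -sumr_const; apply: eq_bigr => v _.
  have /forallP/(_ v)/eqP <- := regE.
  rewrite -natrD; congr _%:R; rewrite -(cardsID Y [set u | adj E v u]) addnC.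
  by congr (_ + _)%N; apply: eq_card => u; rewrite !inE andbC.
have := mixing X Y; rewrite -/Y -/X => mXY.
apply: le_trans (lerB (lexx _) mXY).
have d0 : 0 < d%:R :> R by rewrite ltr0n.
have XY : #|X|%:R * #|Y|%:R / n%:R <= #|X|%:R * W / n%:R.
  by rewrite ler_wpM2r ?invr_ge0 // ler_wpM2l.
have e4 : eps ^+ 4 * (#|X|%:R + #|Y|%:R) <= eps ^+ 4 * (#|X|%:R + W).
  by rewrite ler_wpM2l ?exprn_ge0 ?(ltW eps_gt0) // lerD2l.
have -> : d%:R * #|X|%:R - (d%:R * #|X|%:R * #|Y|%:R / n%:R + eps ^+ 4 * d%:R * (#|X|%:R + #|Y|%:R) / 2)
  = d%:R * (#|X|%:R - #|X|%:R * #|Y|%:R / n%:R - eps ^+ 4 * (#|X|%:R + #|Y|%:R) / 2) by ring.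
by rewrite ler_pM2l //; lra.
Qed.

Lemma phase_ge (st st' : {set 'I_n} * {set 'I_n} * {set 'I_n}) (x W : R)
    (X := processed st' :\: processed st) :
  y <= x -> x <= 1 / 8 -> #|discovered st'|%:R + #|dead st'|%:R <= W ->
  expR ((1 + eps) * (x - y) *
        (#|X|%:R - #|X|%:R * W / n%:R - eps ^+ 4 * (#|X|%:R + W) / 2))
    <= gain p y (1 - x) ^- queries E st st'.
Proof.
move=> yx x2 hW; have [g0 g1 ge] := gain_bounds yx x2.
apply: (@le_trans _ _ (expR (p * (x - y)) ^+ queries E st st')); last first.
  rewrite -[leLHS]invrK lef_pV2 ?posrE ?invr_gt0 ?exprn_gt0 ?expR_gt0 //.
  by rewrite -exprVn -expRN lerXn2r // nnegrE ltW ?expR_gt0.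
rewrite -expRM_natl ler_expR.
have d0 : 0 < d%:R :> R by rewrite ltr0n.
have -> : (queries E st st')%:R * (p * (x - y)) = (1 + eps) * (x - y) * ((queries E st st')%:R / d%:R).
  by field; rewrite gt_eqF.
rewrite ler_wpM2l ?mulr_ge0 ?subr_ge0 ?addr_ge0 ?(ltW eps_gt0) //.
by rewrite ler_pdivlMr // mulrC; apply: queries_ge.
Qed.

(** The first [j] processed vertices carry the weight [1 - x1] and the others
    the weight [1 - x2]; [a] is the number of vertices discovered at the change.
    Queries of the first phase go to all vertices but these [a] and the
    boundary, those of the second phase to all vertices but [S] and its
    boundary. The further weights [zs] are not consumed, which allows one list
    to serve sets of all sizes. *)
Lemma explore_two_phase_ge (F : {set {set 'I_n}}) (S rho : {set 'I_n})
    (j : nat) (x1 x2 : R) (zs : seq R) (k := #|S|) (m := #|ext_nbhd F S|) :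
  F \subset E -> rho \subset S -> spreads F S rho -> (j <= k)%N ->
  y <= 1 -> y <= x1 -> x1 <= 1 / 8 -> y <= x2 -> x2 <= 1 / 8 ->
  {in zs, forall z, 0 <= z /\ 0 < gain p y z} ->
  exists2 a : nat, (a <= k)%N &
  expR (- ((x1 + x1 ^+ 2) * a%:R) - (x2 + x2 ^+ 2) * (k%:R - a%:R) + m%:R * ln y
    + (1 + eps) * (x1 - y) * (j%:R - j%:R * (a%:R + m%:R) / n%:R
                              - eps ^+ 4 * (j%:R + (a%:R + m%:R)) / 2)
    + (1 + eps) * (x2 - y) * ((k - j)%:R - (k - j)%:R * (k%:R + m%:R) / n%:R
                              - eps ^+ 4 * ((k - j)%:R + (k%:R + m%:R)) / 2))
  <= explore E p y (nseq j (1 - x1) ++ nseq (k - j) (1 - x2) ++ zs)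
       (set0, rho, set0) F.
Proof.
move=> FE rhoS spr jk y1 yx1 x12 yx2 x22 zs0.
have expx (x : R) : 0 <= x -> x <= 1 / 8 -> forall i : nat,
    expR (- ((x + x ^+ 2) * i%:R)) <= (1 - x) ^+ i.
  move=> x0 x12' i; rewrite -mulNr mulrC expRM_natl lerXn2r ?nnegrE ?expR_ge0 ?expR_le_geom //; lra.
have y0' := y_gt0.
have [x10 x20] : 0 <= x1 /\ 0 <= x2 by lra.
have [z10 z20] : 0 < 1 - x1 /\ 0 < 1 - x2 by lra.
have [z11 z21] : 1 - x1 <= 1 /\ 1 - x2 <= 1 by lra.
set st0 := (set0, rho, set0).
pose st1 := iter j (follow E F S) st0; pose st2 := iter (k - j) (follow E F S) st1.
have st2E : st2 = iter k (follow E F S) st0 by rewrite /st2 /st1 -iterD subnK.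
have [pd1 rd1 dS1 dN1 _] := run_inv FE rhoS j; rewrite -/st0 -/st1 in pd1 rd1 dS1 dN1.
have [_ _ _ dN2 _] := run_inv FE rhoS k; rewrite -/st0 -st2E in dN2.
have c1 := run_card FE rhoS spr jk; rewrite -/st0 -/st1 in c1.
have [p2 d2] := run_end FE rhoS spr; rewrite -/st0 -/k -st2E in p2 d2.
have [g10 g11 _] := gain_bounds yx1 x12; have [g20 g21 _] := gain_bounds yx2 x22.
have [pp12 dd12 mm12] := iter_follow_sub E F S (k - j) st1; rewrite -/st2 in pp12 dd12 mm12.
have y0 := ltW y_gt0.
exists #|discovered st1|; first exact: subset_leq_card.
have zs0' : {in nseq (k - j) (1 - x2) ++ zs, forall z, 0 <= z /\ 0 < gain p y z}.
  move=> z; rewrite mem_cat mem_nseq => /orP[/andP[_ /eqP ->]|/zs0 //]; split=> //; exact: ltW.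
apply: le_trans (explore_ge E F S j st0 z10 y_gt0 g10 g11 zs0').
rewrite -/st1.
have h2 := explore_ge E F S (k - j) st1 z20 y_gt0 g20 g21 zs0; rewrite -/st2 in h2.
have e2 : explore E p y zs st2 F = 1.
  case: (zs) => //= z zs'; rewrite p2 d2; case: pickP => // v; by rewrite setDv inE.
rewrite e2 mulr1 in h2.
have m1 : (#|dead st2| <= m)%N by apply: subset_leq_card.
have m0 : (#|dead st1| <= #|dead st2|)%N by apply: subset_leq_card.
have hW1 : #|discovered st1|%:R + #|dead st1|%:R <= #|discovered st1|%:R + m%:R :> R.
  by rewrite lerD2l ler_nat (leq_trans m0).
have hW2 : #|discovered st2|%:R + #|dead st2|%:R <= k%:R + m%:R :> R.
  by rewrite d2 lerD2l ler_nat.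
have ph1 := @phase_ge st0 st1 x1 _ yx1 x12 hW1.
have ph2 := @phase_ge st1 st2 x2 _ yx2 x22 hW2.
have X1 : #|processed st1 :\: processed st0| = j by rewrite setD0.
have X2 : #|processed st2 :\: processed st1| = (k - j)%N by rewrite cardsD (setIidPr pp12) p2 c1.
rewrite X1 in ph1; rewrite X2 in ph2.
have -> : expR (- ((x1 + x1 ^+ 2) * #|discovered st1|%:R) - (x2 + x2 ^+ 2) * (k%:R - #|discovered st1|%:R) + m%:R * ln y
    + (1 + eps) * (x1 - y) * (j%:R - j%:R * (#|discovered st1|%:R + m%:R) / n%:R
                              - eps ^+ 4 * (j%:R + (#|discovered st1|%:R + m%:R)) / 2)
    + (1 + eps) * (x2 - y) * ((k - j)%:R - (k - j)%:R * (k%:R + m%:R) / n%:R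
                              - eps ^+ 4 * ((k - j)%:R + (k%:R + m%:R)) / 2))
  = expR (- ((x1 + x1 ^+ 2) * #|discovered st1|%:R)) * expR (- ((x2 + x2 ^+ 2) * (k - #|discovered st1|)%:R))
    * expR (m%:R * ln y) * expR ((1 + eps) * (x1 - y) * (j%:R - j%:R * (#|discovered st1|%:R + m%:R) / n%:R
                              - eps ^+ 4 * (j%:R + (#|discovered st1|%:R + m%:R)) / 2))
    * expR ((1 + eps) * (x2 - y) * ((k - j)%:R - (k - j)%:R * (k%:R + m%:R) / n%:R
                              - eps ^+ 4 * ((k - j)%:R + (k%:R + m%:R)) / 2)).
  rewrite -!expRD [(k - #|discovered st1|)%:R]natrB; last exact: subset_leq_card.
  by congr expR; rewrite mulrBr; ring.
rewrite [expR (m%:R * _)]expRM_natl lnK ?posrE //.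
set A1 := expR _; set A2 := expR _; set P1 := expR _; set P2 := expR _.
rewrite -!mulrA.
set Ex := explore _ _ _ _ _ _ in h2 *; set a := #|discovered st1| in A1 A2 P1 ph1 *.
have hA1 : A1 <= (1 - x1) ^+ (a - #|discovered st0|).
  apply: le_trans (expx _ x10 x12 _) _.
  by rewrite ler_wiXn2l ?leq_subr // ltW.
have hA2 : A2 <= (1 - x2) ^+ (#|discovered st2| - a) by rewrite d2; apply: expx.
have hy : y ^+ m <= y ^+ (#|dead st1| - #|dead st0|) * y ^+ (#|dead st2| - #|dead st1|).
  by rewrite -exprD ler_wiXn2l // cards0 subn0 subnKC.
apply: (@le_trans _ _ ((1 - x1) ^+ (a - #|discovered st0|) * ((1 - x2) ^+ (#|discovered st2| - a) *
  ((y ^+ (#|dead st1| - #|dead st0|) * y ^+ (#|dead st2| - #|dead st1|)) *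
   (gain p y (1 - x1) ^- queries E st0 st1 * gain p y (1 - x2) ^- queries E st1 st2))))).
  have e0 (r : R) : 0 <= expR r := expR_ge0 r.
  apply: ler_pM => //; rewrite ?mulr_ge0 ?e0 ?exprn_ge0 //.
  apply: ler_pM => //; rewrite ?mulr_ge0 ?e0 ?exprn_ge0 //.
  apply: ler_pM => //; rewrite ?mulr_ge0 ?e0 ?exprn_ge0 //.
  by apply: ler_pM; [exact: e0 | exact: e0 | exact: ph1 | exact: ph2].
set q1 := gain _ _ _ ^- _; set q2 := gain _ _ _ ^- _ in h2 *.
rewrite -/a in h2.
set b1 := (1 - x1) ^+ _; set b2 := (1 - x2) ^+ _ in h2 *.
set y1' := y ^+ _; set y2' := y ^+ _ in h2 *.
have -> : b1 * (b2 * (y1' * y2' * (q1 * q2))) = b1 * (y1' * (q1 * (b2 * y2' * q2))) by ring.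
rewrite ler_wpM2l ?exprn_ge0 ?(ltW z10) // ler_wpM2l ?exprn_ge0 //.
by rewrite ler_wpM2l // invr_ge0 exprn_ge0 // ltW.
Qed.
End PhaseBound.

(** * Numerical estimates of the exponents *)

Section Exponents.
Variable R : realType.
Local Notation small := (1 / (100 * 100) : R).
Local Notation c := (1 / (10 * 100) : R).

(** The instance of [explore_two_phase_ge] in which both phases have the weight
    [1 - e / 2] and the second one is empty, with [y = e^3]. The main terms are
    [- (e / 2 + e^2 / 4) k] from the discovered vertices and
    [(1 + e) (e / 2) k] from the queries, which leaves [e^2 k / 4]. *)
Lemma connected_exponent (e k n a m L : R) :
  0 < e -> e <= small -> 0 <= k -> 0 < n -> k <= e ^+ 2 * n / 50 ->
  0 <= a -> a <= k -> 0 <= m -> m * L <= c * e ^+ 2 * k -> 1 <= L ->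
  e ^+ 2 * k / 8 <=
  - ((e / 2 + (e / 2) ^+ 2) * a) - (e / 2 + (e / 2) ^+ 2) * (k - a) + m * - (3 * L)
  + (1 + e) * (e / 2 - e ^+ 3) * (k - k * (a + m) / n - e ^+ 4 * (k + (a + m)) / 2)
  + (1 + e) * (e / 2 - e ^+ 3) * (0 - 0 * (k + m) / n - e ^+ 4 * (0 + (k + m)) / 2).
Proof.
move=> e0 e1 k0 n0 kn a0 ak m0 mL L1.
have e20 : 0 < e ^+ 2 by rewrite exprn_gt0.
have e2k : 0 <= e ^+ 2 * k by rewrite mulr_ge0 // ltW.
have mk : m <= c * (e ^+ 2 * k).
  rewrite mulrA; apply: le_trans mL; by rewrite -[leLHS]mulr1 ler_wpM2l.
have e2s : e ^+ 2 <= small.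
  rewrite expr2 -[leRHS]mulr1 ler_pM ?(ltW e0) //; clear -e1; lra.
have mk' : m <= k.
  apply: le_trans mk _; rewrite mulrA -[leRHS]mul1r ler_wpM2r //; clear -e2s; lra.
set q := k / n.
have q1 : q <= e ^+ 2 / 50 by rewrite ler_pdivrMr //; clear -kn; lra.
have q0 : 0 <= q by rewrite divr_ge0 // ltW.
have -> : k * (a + m) / n = q * (a + m) by rewrite /q; ring.
have h1 : q * (a + m) <= e ^+ 2 / 50 * (2 * k).
  apply: ler_pM => //; clear -ak mk' a0 m0; lra.
have e40 : 0 <= e ^+ 4 by rewrite exprn_ge0 // ltW.
have e4 : e ^+ 4 <= small * e ^+ 2.
  have -> : e ^+ 4 = e ^+ 2 * e ^+ 2 by ring.
  by rewrite ler_wpM2r // ltW.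
have h2 : e ^+ 4 * (k + (a + m)) / 2 <= small * e ^+ 2 * (2 * k).
  have : e ^+ 4 * (k + (a + m)) <= small * e ^+ 2 * (3 * k).
    apply: ler_pM => //; clear -ak mk' a0 m0; lra.
  by have := e2k; clear; lra.
have h3 : e ^+ 4 * (0 + (k + m)) / 2 <= small * e ^+ 2 * k.
  have : e ^+ 4 * (0 + (k + m)) <= small * e ^+ 2 * (2 * k).
    apply: ler_pM => //; clear -mk' k0 m0; lra.
  by clear; lra.
set C := (1 + e) * (e / 2 - e ^+ 3).
have C0 : 0 <= C.
  rewrite mulr_ge0 //; first by clear -e0; lra.
  have -> : e / 2 - e ^+ 3 = e * (1 / 2 - e ^+ 2) by ring.
  rewrite mulr_ge0 ?(ltW e0) //; clear -e2s; lra.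
set B1 := k - _ - _; set B2 := 0 - _ - _.
have hB : k * (1 - e ^+ 2 / 20) <= B1 + B2.
  by rewrite /B1 /B2 !mul0r; clear -h1 h2 h3 e2k; lra.
have hC : C * (k * (1 - e ^+ 2 / 20)) <= C * B1 + C * B2 by rewrite -mulrDr ler_wpM2l.
have poly : e / 2 + e ^+ 2 / 2 - 2 * e ^+ 3 <= C * (1 - e ^+ 2 / 20).
  rewrite -subr_ge0.
  have -> : C * (1 - e ^+ 2 / 20) - (e / 2 + e ^+ 2 / 2 - 2 * e ^+ 3)
    = e ^+ 3 * (39 / 40 - (41 / 40) * e + e ^+ 2 / 20 + e ^+ 3 / 20) by rewrite /C; field.
  rewrite mulr_ge0 ?exprn_ge0 ?(ltW e0) //.
  have : 0 <= e ^+ 3 by rewrite exprn_ge0 // ltW.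
  clear -e1 e20; lra.
have hk : k * (e / 2 + e ^+ 2 / 2 - 2 * e ^+ 3) <= C * (k * (1 - e ^+ 2 / 20)).
  rewrite [leRHS](_ : _ = k * (C * (1 - e ^+ 2 / 20))); last by ring.
  by rewrite ler_wpM2l.
have e3k : k * e ^+ 3 <= small * (e ^+ 2 * k).
  have -> : k * e ^+ 3 = e * (e ^+ 2 * k) by ring.
  by rewrite ler_wpM2r.
have -> : - ((e / 2 + (e / 2) ^+ 2) * a) - (e / 2 + (e / 2) ^+ 2) * (k - a)
  = - (k * (e / 2)) - (e ^+ 2 * k) / 4 by field.
by clear -hk hC e3k mL e2k; lra.
Qed.

(** With [t = j / n], the shift [(1 + e) x t] between the two weights is chosen
    so that the terms linear in [a] add up to a nonnegative quantity. What
    remains is at least [x k (e - x - 0.77 k / n)] up to terms of order [e^3 k],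
    and [k / n <= 12 e / 11] makes the bracket positive for [x = e / 12]. *)
Lemma subset_exponent (e k n j a m L : R)
    (x := e / 12) (y := e ^+ 3) (x1 := x - (1 + e) * x * (j / n)) :
  0 < e -> e <= small -> 0 <= k -> 0 < n -> k <= 12 * e * n / 11 ->
  49 / 100 * k <= j -> j <= k / 2 ->
  0 <= a -> a <= k -> 0 <= m -> m * L <= c * e ^+ 2 * k -> 1 <= L ->
  e ^+ 2 * k / (4 * 100) <=
  - ((x1 + x1 ^+ 2) * a) - (x + x ^+ 2) * (k - a) + m * - (3 * L)
  + (1 + e) * (x1 - y) * (j - j * (a + m) / n - e ^+ 4 * (j + (a + m)) / 2)
  + (1 + e) * (x - y) * ((k - j) - (k - j) * (k + m) / n - e ^+ 4 * ((k - j) + (k + m)) / 2).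
Proof.
move=> e0 e1 k0 n0 kn jk1 jk2 a0 ak m0 mL L1.
have e20 : 0 < e ^+ 2 by rewrite exprn_gt0.
have e2k : 0 <= e ^+ 2 * k by rewrite mulr_ge0 // ltW.
have mk : m <= c * (e ^+ 2 * k).
  rewrite mulrA; apply: le_trans mL; by rewrite -[leLHS]mulr1 ler_wpM2l.
have e2s : e ^+ 2 <= small * e by rewrite expr2 ler_wpM2r // ltW.
have mk' : m <= k.
  apply: le_trans mk _; rewrite mulrA -[leRHS]mul1r ler_wpM2r //; clear -e2s e1; lra.
have j0 : 0 <= j by clear -jk1 k0; lra.
have [q qE] : {q | q = k / n} by exists (k / n).
have [t tE] : {t | t = j / n} by exists (j / n).
rewrite /x1 -tE {x1}; move: (erefl x) (erefl y); rewrite {1}/x {1}/y.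
move: x y => x y xE yE; set x1 := x - _.
have q1 : q <= 12 / 11 * e by rewrite qE ler_pdivrMr //; clear -kn; lra.
have q0 : 0 <= q by rewrite qE divr_ge0 // ltW.
have tq : t <= q / 2.
  by rewrite tE ler_pdivrMr // qE mulrAC divfK ?gt_eqF //.
have t0 : 0 <= t by rewrite tE divr_ge0 ?(ltW n0).
have -> : j * (a + m) / n = t * a + t * m by rewrite tE; ring.
have -> : (k - j) * (k + m) / n = q * (k - j) + (q - t) * m by rewrite tE qE; ring.
have x0 : 0 < x by rewrite -xE; clear -e0; lra.
have y0 : 0 < y by rewrite -yE exprn_gt0.
have yx : y <= x / 50.
  have -> : y = e ^+ 2 * e by rewrite -yE; ring.
  have -> : x / 50 = e / (12 * 50) by rewrite -xE; field.
  rewrite [leRHS]mulrC ler_pM2r //; clear -e2s e1; lra.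
have th0 : 0 <= (1 + e) * x * t.
  by rewrite !mulr_ge0 ?(ltW x0) //; clear -e0; lra.
have th1 : (1 + e) * x * t <= x * (2 * e).
  have -> : (1 + e) * x * t = x * ((1 + e) * t) by ring.
  rewrite ler_pM2l //; apply: le_trans (_ : 2 * (6 / 11 * e) <= _); last by clear -e0; lra.
  apply: ler_pM => //; clear -e0 e1 tq q1; lra.
have xe : x * (2 * e) <= x / 50.
  rewrite ler_pM2l //; clear -e1; lra.
have x1l : x / 2 <= x1 by rewrite /x1; clear -th1 xe x0; lra.
have x1u : x1 <= x by rewrite /x1; clear -th0; lra.
have xe12 : x = e / 12 by [].
set C1 := (1 + e) * (x1 - y); set C2 := (1 + e) * (x - y).
have C10 : 0 <= C1 by rewrite /C1 mulr_ge0 //; clear -e0 x1l yx x0; lra.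
have C20 : 0 <= C2 by rewrite /C2 mulr_ge0 //; clear -e0 yx x0; lra.
have C2u : C2 <= 1.
  apply: le_trans (_ : 2 * (1 / 2) <= _); last by clear; lra.
  by apply: ler_pM; clear -e0 e1 yx x0 y0 xe12; lra.
have C1u : C1 <= 1.
  apply: le_trans C2u; rewrite /C1 /C2 ler_wpM2l //; clear -e0 x1u; lra.
have e40 : 0 <= e ^+ 4 by rewrite exprn_ge0 // ltW.
have e3k0 : 0 <= e ^+ 3 * k by rewrite mulr_ge0 // exprn_ge0 // ltW.
have e4k : e ^+ 4 * k <= small * (e ^+ 3 * k).
  have -> : e ^+ 4 * k = e * (e ^+ 3 * k) by ring.
  by rewrite ler_wpM2r.
have e3k : e ^+ 3 * k <= small * (e ^+ 2 * k).
  have -> : e ^+ 3 * k = e * (e ^+ 2 * k) by ring.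
  by rewrite ler_wpM2r.
have qm : q * m <= e ^+ 3 * k.
  have -> : e ^+ 3 * k = e * (e ^+ 2 * k) by ring.
  apply: le_trans (_ : 12 / 11 * e * (c * (e ^+ 2 * k)) <= _); first by apply: ler_pM.
  have : 0 <= e * (e ^+ 2 * k) by rewrite mulr_ge0 // ltW.
  clear; lra.
have tm0 : 0 <= t * m by rewrite mulr_ge0.
have tm : t * m <= q * m by rewrite ler_wpM2r //; clear -tq q0; lra.
have Er1 : e ^+ 4 * (j + (a + m)) / 2 <= e ^+ 3 * k.
  have : e ^+ 4 * (j + (a + m)) <= e ^+ 4 * (3 * k).
    by rewrite ler_wpM2l //; clear -k0 jk2 ak mk'; lra.
  clear -e4k e3k0; lra.
have Er2 : e ^+ 4 * ((k - j) + (k + m)) / 2 <= e ^+ 3 * k.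
  have : e ^+ 4 * ((k - j) + (k + m)) <= e ^+ 4 * (3 * k).
    by rewrite ler_wpM2l //; clear -j0 k0 mk'; lra.
  clear -e4k e3k0; lra.
have hB1 : C1 * (j - t * a - 2 * (e ^+ 3 * k)) <=
    C1 * (j - (t * a + t * m) - e ^+ 4 * (j + (a + m)) / 2).
  by rewrite ler_wpM2l //; clear -tm qm Er1; lra.
have hB2 : C2 * ((k - j) - q * (k - j) - 2 * (e ^+ 3 * k)) <=
    C2 * ((k - j) - (q * (k - j) + (q - t) * m) - e ^+ 4 * ((k - j) + (k + m)) / 2).
  by rewrite ler_wpM2l //; clear -tm0 qm Er2; lra.
have hC1 : C1 * (e ^+ 3 * k) <= e ^+ 3 * k by rewrite -[leRHS]mul1r ler_wpM2r.
have hC2 : C2 * (e ^+ 3 * k) <= e ^+ 3 * k by rewrite -[leRHS]mul1r ler_wpM2r.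
(* The number [a] of discovered vertices drops out here. *)
have ha : 0 <= - ((x1 + x1 ^+ 2) * a) + (x + x ^+ 2) * a - C1 * (t * a).
  have -> : - ((x1 + x1 ^+ 2) * a) + (x + x ^+ 2) * a - C1 * (t * a)
    = a * ((1 + e) * t * ((x - x1) + y) + (x - x1) * (x + x1)).
    by rewrite /C1 /x1; ring.
  rewrite mulr_ge0 // addr_ge0 // !mulr_ge0 //; clear -e0 x0 y0 x1u x1l; lra.
have main : x * k - x * q * k * (77 / 100) - y * k
    <= (x1 - y) * j + (x - y) * ((k - j) - q * (k - j)).
  have tj : t * j <= q / 2 * (k / 2) by apply: ler_pM.
  have xtj : (1 + e) * x * (t * j) <= (1 + e) * x * (q / 2 * (k / 2)).
    by rewrite ler_wpM2l // mulr_ge0 //; clear -e0 x0; lra.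
  have xqk : 0 <= x * q * k by rewrite !mulr_ge0 ?(ltW x0).
  have exqk : e * (x * q * k) <= small * (x * q * k) by rewrite ler_wpM2r.
  have xqj : x * q * (49 / 100 * k) <= x * q * j.
    by rewrite ler_wpM2l ?mulr_ge0 ?(ltW x0).
  have yq : 0 <= y * (q * (k - j)).
    by rewrite !mulr_ge0 ?(ltW y0) //; clear -k0 jk2; lra.
  rewrite /x1; clear -xtj exqk xqj yq xqk; lra.
have main' : (1 + e) * (x * k - x * q * k * (77 / 100) - y * k) <=
   C1 * j + C2 * ((k - j) - q * (k - j)).
  have -> : C1 * j + C2 * ((k - j) - q * (k - j))
    = (1 + e) * ((x1 - y) * j + (x - y) * ((k - j) - q * (k - j))).
    by rewrite /C1 /C2; ring.
  rewrite ler_wpM2l //; clear -e0; lra.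
have xqk : x * q * k <= 1 / 11 * (e ^+ 2 * k).
  have -> : 1 / 11 * (e ^+ 2 * k) = x * (12 / 11 * e) * k by rewrite -xE; field.
  by rewrite ler_wpM2r ?ler_wpM2l ?(ltW x0).
have xqk1 : (1 + e) * (x * q * k) <= 1 / 11 * (e ^+ 2 * k) + e ^+ 3 * k.
  apply: le_trans (_ : (1 + e) * (1 / 11 * (e ^+ 2 * k)) <= _).
    rewrite ler_wpM2l //; clear -e0; lra.
  clear -e3k0; lra.
have yk : (1 + e) * (y * k) <= 2 * (e ^+ 3 * k).
  rewrite -yE.
  rewrite ler_wpM2r //; clear -e1; lra.
have xk : (1 + e) * (x * k) - (x + x ^+ 2) * k = 11 / 144 * (e ^+ 2 * k) by rewrite -xE; field.
by clear -hB1 hB2 hC1 hC2 ha main' xqk1 yk xk e3k mL e2k; lra.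
Qed.
End Exponents.

(** * Logarithms, boundary edges, reachability and probability bounds *)

Section Logs.
Variable R : realType.

Lemma expR_half_le2 : expR (1 / 2) <= 2 :> R.
Proof.
have h : 1 / 2 <= expR (- (1 / 2)) :> R by apply: le_trans (expR_ge1Dx _); lra.
have : expR (1 / 2) * (1 / 2) <= 1 :> R.
  by rewrite -[leRHS](expRxMexpNx_1 (1 / 2)) ler_pM2l ?expR_gt0.
lra.
Qed.

Lemma ln_inv_ge1 (e : R) : 0 < e -> e <= 1 / 4 -> 1 <= ln (1 / e).
Proof.
move=> e0 e1; rewrite -ler_expR lnK ?posrE ?divr_gt0 //.
have h2 := expR_half_le2.
have -> : expR 1 = expR (1 / 2) * expR (1 / 2) :> R by rewrite -expRD; congr expR; lra.
apply: le_trans (_ : 2 * 2 <= _); first by apply: ler_pM => //; apply: expR_ge0.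
rewrite ler_pdivlMr //; lra.
Qed.

Lemma ln_inv_le (e : R) : 0 < e -> ln (1 / e) <= 1 / e.
Proof.
move=> e0; have := expR_ge1Dx (ln (1 / e)); rewrite lnK ?posrE ?divr_gt0 //; lra.
Qed.

Lemma ln_expn_inv (e : R) i : 0 < e -> ln (e ^+ i) = - (i%:R * ln (1 / e)).
Proof. by move=> e0; rewrite lnXn // div1r lnV ?posrE // mulrN opprK mulr_natl. Qed.

Lemma expn_expR (e : R) i : 0 < e -> e ^+ i = expR (- (i%:R * ln (1 / e))).
Proof. by move=> e0; rewrite -ln_expn_inv // lnK // posrE exprn_gt0. Qed.

Lemma expR_ge_half_sqr (t : R) : 0 <= t -> t ^+ 2 / 2 <= expR t.
Proof. by move=> /(expR_ge1Dxn 1) h; apply: le_trans h; rewrite lerDr. Qed.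

End Logs.

Lemma expect_pow_inter (R : realType) (p b : R) (I : finType) (B X : {set I}) :
  B \subset X -> expect p X (fun F => b ^+ #|F :&: B|) = (1 + p * (b - 1)) ^+ #|B|.
Proof.
move=> BX; transitivity (expect p B (fun N => b ^+ #|N|)).
  rewrite -(@expect_preimset _ _ _ _ id B X); last first.
  - by rewrite imset_id.
  - by move=> x y _ _.
  apply: eq_expect => F _; congr (_ ^+ _); apply: eq_card => u.
  by rewrite !inE andbC.
have -> : 1 + p * (b - 1) = p * b + (1 - p) by ring.
by rewrite -sum_powerset; apply: eq_bigr => N _; rewrite exprMn mulrAC.
Qed.

Section Touching.
Variables (T : finType) (E : {set {set T}}).

Definition touching (M : {set T}) : {set {set T}} := [set e in E | ~~ [disjoint e & M]].

(** Each such edge is given by a vertex of [M] and one of its neighbours. *)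
Lemma card_touching d (M : {set T}) : simple_graph E -> regular E d ->
  (#|touching M| <= d * #|M|)%N.
Proof.
move=> /forallP sE /forallP rE.
pose f (u : T * T) := [set u.1; u.2].
pose Q := [set u : T * T | (u.1 \in M) && adj E u.1 u.2].
have sub : touching M \subset f @: Q.
  apply/subsetP => e; rewrite inE => /andP[eE]; rewrite -setI_eq0 => /set0Pn[v].
  rewrite inE => /andP[ve vM]; have := sE e; rewrite eE /= => /cards2P[a [b [ab eab]]].
  move: ve; rewrite eab !inE => /orP[] /eqP vE; apply/imsetP.
    by exists (v, b); rewrite /f /= ?inE /= ?vM /adj /= vE -?eab.
  by exists (v, a); rewrite /f /= ?inE /= ?vM /adj /= vE setUC -?eab.
apply: leq_trans (subset_leq_card sub) (leq_trans (leq_imset_card _ _) _).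
have -> : #|Q| = (\sum_(v in M) d)%N.
  rewrite -sum1_card.
  rewrite (eq_bigl (fun u : T * T => (u.1 \in M) && adj E u.1 u.2)); last by move=> u; rewrite inE.
  rewrite -(pair_big_dep (fun v => v \in M) (fun v u => adj E v u) (fun _ _ => 1%N)) /=.
  by apply: eq_bigr => v _; have /eqP <- := rE v; rewrite -sum1_card; apply: eq_bigl => u; rewrite inE.
by rewrite sum_nat_const mulnC.
Qed.

(** Choosing for each such vertex an edge towards [M] is injective, since
    exactly one endpoint of the edge lies in [S]. *)
Lemma card_boundary (F : {set {set T}}) (S M : {set T}) :
  F \subset E -> [disjoint S & M] ->
  (#|[set x in S | [exists u in M, adj F x u]]| <= #|F :&: touching M|)%N.
Proof.
move=> FE dSM; set P := [set x in S | _].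
pose nb x := odflt x [pick u in M | adj F x u].
have nbP x : x \in P -> nb x \in M /\ adj F x (nb x).
  rewrite inE /nb => /andP[_ /existsP[u uM]]; case: pickP => [w /andP[]//|/(_ u)].
  by rewrite uM.
rewrite -(@card_in_imset _ _ (fun x => [set x; nb x]) P).
  apply: subset_leq_card; apply/subsetP => _ /imsetP[x xP ->].
  have [nM xn] := nbP x xP; rewrite !inE -/(adj F x (nb x)) xn /=.
  rewrite (subsetP FE _ xn) /=; apply/negP => /disjointFr/(_ (set22 x (nb x))).
  by rewrite nM.
move=> x u xP uP xu; have [nM _] := nbP u uP.
have : x \in [set u; nb u] by rewrite -xu set21.
rewrite !inE => /orP[/eqP //|/eqP xnu]; move: xP; rewrite inE => /andP[xS _].
by have := disjointFr dSM xS; rewrite xnu nM.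
Qed.

End Touching.

Section Spreading.
Variables (T : finType) (F : {set {set T}}).

Lemma connected_spreads (S : {set T}) (v : T) :
  connected_on F S -> v \in S -> spreads F S [set v].
Proof.
move=> /forallP conS vS D vD DS cl; apply/eqP; rewrite eqEsubset DS /=.
apply/subsetP => u uS; have := conS v; rewrite vS => /forallP/(_ u).
rewrite uS /= => vu.
have clD : fingraph.closed (adj (Defs.induced F S)) [in D].
  apply: intro_closed; first exact: sym_connect_sym (@adj_sym _ _).
  move=> x w; rewrite /adj inE => /andP[xw wS] xD; apply: (cl x w) => //.
  by apply: (subsetP wS); rewrite set22.
have := closed_connect clD vu; rewrite -[u \in D]/(u \in [in D]) => /esym.
by rewrite !unfold_in => ->; apply: (subsetP vD); rewrite set11.
Qed.

(** The vertices of [S] that are not reached would form a union of components of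
    [F]: an edge from them to the outside of [S] starts at a root. But [L] is a
    single component and [v] is reached. This also covers [S = L], where [v] is
    the only root. *)
Lemma boundary_spreads (L S : {set T}) (v : T) :
  L \in components F -> S \subset L -> v \in S ->
  spreads F S (v |: [set x in S | [exists u in ext_nbhd F S, adj F x u]]).
Proof.
move=> /imsetP[x0 _ LE] SL vS D rhoD DS cl; apply/eqP; rewrite eqEsubset DS /=.
apply/subsetP => z zS; apply: contraT => zD.
have csym : connect_sym (adj F) := sym_connect_sym (@adj_sym _ _).
have zv : connect (adj F) z v.
  have := subsetP SL _ zS; have := subsetP SL _ vS; rewrite LE !inE => x0v x0z.
  by apply: connect_trans x0v; rewrite csym.
have clZ : fingraph.closed (adj F) [in S :\: D].
  apply: intro_closed => // x w xw; rewrite !inE => /andP[xD xS].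
  case: (boolP (w \in S)) => wS.
    rewrite andbT; apply: contra xD => wD; apply: (cl w x) => //.
    by rewrite adj_sym.
  case/negP: xD; apply: (subsetP rhoD); rewrite !inE xS /=; apply/orP; right.
  apply/existsP; exists w; rewrite xw andbT inE wS /=.
  by apply/existsP; exists x; rewrite xS.
have := closed_connect clZ zv; rewrite !inE zS zD /= => /esym/andP[/negP[]].
by apply: (subsetP rhoD); rewrite setU11.
Qed.

End Spreading.

(** Markov's inequality for an [f] that is at least one on the failures. *)
Lemma perc_prob_bounds (R : realType) (T : finType) (E : {set {set T}}) (p : R)
    (A : {set {set T}} -> Prop) (f : {set {set T}} -> R) :
  0 <= p -> p <= 1 -> (forall F, 0 <= f F) ->
  (forall F : {set {set T}}, F \subset E -> ~ A F -> 1 <= f F) ->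
  1 - expect p E f <= perc_prob E p A /\ perc_prob E p A <= 1.
Proof.
move=> p0 p1 f0 hf.
have w0 (F : {set {set T}}) : 0 <= p ^+ #|F| * (1 - p) ^+ #|E :\: F|.
  by rewrite mulr_ge0 ?exprn_ge0 ?subr_ge0.
have e1 := expect_const p E 1.
have eA : perc_prob E p A + \sum_(F in powerset E | ~~ `[< A F >])
    p ^+ #|F| * (1 - p) ^+ #|E :\: F| = 1.
  rewrite -[RHS]e1 /expect [RHS](bigID (fun F => `[< A F >])) /=.
  by congr (_ + _); apply: eq_bigr => F _; rewrite mulr1.
split; last by rewrite -eA lerDl sumr_ge0.
rewrite lerBlDr -eA lerD2l /expect [leRHS](bigID (fun F => `[< A F >])) /=.
apply: ler_wpDl; first by apply: sumr_ge0 => F _; rewrite mulr_ge0.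
apply: ler_sum => F /andP[]; rewrite powersetE => FE /asboolPn nA.
by rewrite -[leLHS]mulr1 ler_wpM2l ?hf.
Qed.

(** * Sets of small boundary have a large weight *)

Local Notation retention eps d := ((1 + eps) / d%:R).
(* The expansion constant. It has to be small enough for the boundary to cost
   less than the exploration gains, and for the number of edges at the boundary
   to be controlled by [crowded_weight_ge]. *)
Local Notation c0 := (1 / (10 * 100 * 100)).

(** Rounding [k / 2] down changes it by at most one per cent. *)
Lemma half_ge (R : realType) k : (50 <= k)%N -> 49 / 100 * k%:R <= k./2%:R :> R.
Proof.
move=> k50; have h : (49 * k <= 100 * k./2)%N by lia.
by move: h; rewrite -(ler_nat R) !natrM => h; lra.
Qed.

(** What the argument uses of an [(n, d, lambda)]-graph with
    [lambda <= eps^4 d], for [n] large enough in terms of [eps]. *)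
Record regime (R : realType) (n d : nat) (E : {set {set 'I_n}}) (eps : R) : Prop :=
  Regime {
    degree_gt0 : (0 < d)%N;
    regime_simple : simple_graph E;
    regime_regular : regular E d;
    eps_gt0 : 0 < eps;
    eps_le : eps <= 1 / (100 * 100 * (100 * 100));
    regime_mixing : forall X Y : {set 'I_n},
      \sum_(v in X) #|[set w in Y | adj E v w]|%:R
        <= d%:R * #|X|%:R * #|Y|%:R / n%:R
           + (eps ^+ 4 * d%:R) * (#|X|%:R + #|Y|%:R) / 2 :> R;
    retention_le1 : (1 + eps) / d%:R <= 1;
    order_large : 100 * 100 * (100 * 100) <= eps ^+ 5 * n%:R
  }.

Definition flat_schedule (R : realType) (n : nat) (eps : R) : seq R := nseq n (1 - eps / 2).

(** The rate [eps / 12] less the shift that [subset_exponent] asks for when the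
    first phase ends after [k / 2] processed vertices. *)
Definition early_rate (R : realType) (n : nat) (eps : R) (k : nat) : R :=
  eps / 12 - (1 + eps) * (eps / 12) * (k./2%:R / n%:R).

Definition two_phase_schedule (R : realType) (n : nat) (eps : R) (k : nat) : seq R :=
  nseq k./2 (1 - early_rate n eps k) ++ nseq (k - k./2) (1 - eps / 12).

Lemma eps_small (R : realType) (n d : nat) (E : {set {set 'I_n}}) (eps : R)
    (H : regime d E eps) :
  eps <= 1 / (100 * 100).
Proof. apply: le_trans (eps_le H) _; lra. Qed.

Lemma ln_inv_eps_ge1 (R : realType) (n d : nat) (E : {set {set 'I_n}}) (eps : R)
    (H : regime d E eps) : 1 <= ln (1 / eps).
Proof. apply: ln_inv_ge1 (eps_gt0 H) _; have := eps_small H; lra. Qed.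

Lemma order_gt0 (R : realType) (n d : nat) (E : {set {set 'I_n}}) (eps : R)
    (H : regime d E eps) : 0 < n%:R :> R.
Proof.
have e5 : 0 < eps ^+ 5 by rewrite exprn_gt0 // (eps_gt0 H).
rewrite -(pmulr_rgt0 _ e5); have := order_large H; clear; lra.
Qed.

Lemma eps3_bounds (R : realType) (n d : nat) (E : {set {set 'I_n}}) (eps : R)
    (H : regime d E eps) :
  [/\ 0 < eps ^+ 3, eps ^+ 3 <= eps / 100 & eps ^+ 3 <= 1].
Proof.
have e0 := eps_gt0 H; have e1 := eps_small H.
have h : eps ^+ 3 <= eps / 100.
  have -> : eps ^+ 3 = eps * eps ^+ 2 by ring.
  rewrite ler_pM2l // expr2 -[leRHS]mul1r; apply: ler_pM; rewrite ?(ltW e0) //; clear -e1; lra.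
split=> //; first by rewrite exprn_gt0.
by clear -h e0 e1; lra.
Qed.

Lemma early_rate_bounds (R : realType) (n d : nat) (E : {set {set 'I_n}}) (eps : R)
    (H : regime d E eps) k :
  (k <= n)%N -> eps ^+ 3 <= early_rate n eps k /\ early_rate n eps k <= eps / 12.
Proof.
move=> kn; have n0 := order_gt0 H; have [y0 y1 _] := eps3_bounds H; have e0 := eps_gt0 H.
have e1 := eps_small H.
have q0 : 0 <= k./2%:R / n%:R :> R by rewrite divr_ge0 // ltW.
have q1 : k./2%:R / n%:R <= 1 / 2 :> R.
  rewrite ler_pdivrMr // mulrC mul1r ler_pdivlMr // -natrM ler_nat.
  have := half_leq kn; rewrite -[X in (_ * 2 <= X)%N](odd_double_half n) -muln2; lia.
rewrite /early_rate; move: (_ / n%:R) q0 q1 => q q0 q1.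
have h : 0 <= eps * q by rewrite mulr_ge0 // ltW.
have h' : eps * q <= 1 / 100 * q by rewrite ler_wpM2r //; clear -e1; lra.
have -> : eps / 12 - (1 + eps) * (eps / 12) * q = eps / 12 * (1 - q - eps * q) by ring.
split.
  apply: le_trans y1 _; have -> : eps / 100 = eps / 12 * (12 / 100) by field.
  rewrite ler_pM2l; [clear -q1 h'; lra | clear -e0; lra].
rewrite -[leRHS]mulr1 ler_pM2l; [clear -q0 h; lra | clear -e0; lra].
Qed.

Lemma flat_schedule_gain (R : realType) (n d : nat) (E : {set {set 'I_n}}) (eps : R)
    (H : regime d E eps) :
  {in flat_schedule n eps, forall z, 0 <= z /\ 0 < gain (retention eps d) (eps ^+ 3) z}.
Proof.
move=> z; rewrite mem_nseq => /andP[_ /eqP ->].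
have [y0 y1 _] := eps3_bounds H; have e0 := eps_gt0 H; have e1 := eps_small H.
have yx : eps ^+ 3 <= eps / 2 by clear -y1 e0; lra.
have x2 : eps / 2 <= 1 / 8 by clear -e1; lra.
have [g _ _] := gain_bounds e0 y0 (retention_le1 H) yx x2.
by split=> //; clear -e1; lra.
Qed.

Lemma two_phase_schedule_gain (R : realType) (n d : nat) (E : {set {set 'I_n}}) (eps : R)
    (H : regime d E eps) k :
  (k <= n)%N ->
  {in two_phase_schedule n eps k, forall z, 0 <= z /\ 0 < gain (retention eps d) (eps ^+ 3) z}.
Proof.
move=> kn z; have [y0 y1 _] := eps3_bounds H; have e0 := eps_gt0 H; have e1 := eps_small H.
have [r0 r1] := early_rate_bounds H kn.
have go x : eps ^+ 3 <= x -> x <= eps / 12 -> 0 <= 1 - x /\ 0 < gain (retention eps d) (eps ^+ 3) (1 - x).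
  move=> yx x12; have x8 : x <= 1 / 8 by clear -x12 e1; lra.
  have [g _ _] := gain_bounds e0 y0 (retention_le1 H) yx x8.
  by split=> //; clear -x8; lra.
rewrite mem_cat !mem_nseq => /orP[] /andP[_ /eqP ->]; apply: go => //.
by clear -y1 e0; lra.
Qed.

(** The lower bound [16 ln n / eps^2] on the size of [S] is what turns
    [exp (eps^2 |S| / 8)] into [n^2]. *)
Lemma poor_connected_explore_ge (R : realType) (n d : nat) (E : {set {set 'I_n}}) (eps : R)
    (H : regime d E eps) (F : {set {set 'I_n}}) (S : {set 'I_n}) (v : 'I_n) :
  F \subset E -> connected_on F S -> v \in S ->
  16 * ln n%:R / eps ^+ 2 <= #|S|%:R -> #|S|%:R <= eps ^+ 2 * n%:R / 50 ->
  #|ext_nbhd F S|%:R < c0 * eps ^+ 2 * #|S|%:R / ln (1 / eps) ->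
  n%:R ^+ 2 <= explore E (retention eps d) (eps ^+ 3) (flat_schedule n eps) (set0, [set v], set0) F.
Proof.
move=> FE conS vS Sge Sle Nlt.
have [y0 y1 y2] := eps3_bounds H; have e0 := eps_gt0 H; have e1 := eps_small H.
have n0 := order_gt0 H; have L1 := ln_inv_eps_ge1 H.
have yx : eps ^+ 3 <= eps / 2 by clear -y1 e0; lra.
have x8 : eps / 2 <= 1 / 8 by clear -e1; lra.
have rS : [set v] \subset S by rewrite sub1set.
have Sn : (#|S| <= n)%N by rewrite -[X in (_ <= X)%N]card_ord max_card.
have zsE : flat_schedule n eps = nseq #|S| (1 - eps / 2) ++ nseq (#|S| - #|S|) (1 - eps / 2)
    ++ nseq (n - #|S|) (1 - eps / 2).
  by rewrite subnn /= -nseqD subnKC.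
have zs0 : {in nseq (n - #|S|) (1 - eps / 2), forall z, 0 <= z /\ 0 < gain (retention eps d) (eps ^+ 3) z}.
  by move=> z zin; apply: (flat_schedule_gain H); rewrite zsE !mem_cat zin !orbT.
have [a ak] := explore_two_phase_ge (degree_gt0 H) (regime_regular H) e0 (regime_mixing H) y0 (retention_le1 H) FE rS
  (connected_spreads conS vS) (leqnn #|S|) y2 yx x8 yx x8 zs0.
rewrite -zsE; apply: le_trans; rewrite subnn.
have -> : n%:R ^+ 2 = expR (2 * ln n%:R) :> R.
  by rewrite mulr_natl -lnXn // lnK // posrE exprn_gt0.
rewrite ler_expR ln_expn_inv //.
have e20 : 0 < eps ^+ 2 by rewrite exprn_gt0.
apply: (@le_trans _ _ (eps ^+ 2 * #|S|%:R / 8)).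
  move: Sge; rewrite ler_pdivrMr //; clear; lra.
apply: connected_exponent => //; rewrite ?ler_nat //.
move: Nlt; rewrite ltr_pdivlMr; last by apply: lt_le_trans L1.
have : 0 <= eps ^+ 2 * #|S|%:R by rewrite mulr_ge0 // ltW.
clear; lra.
Qed.

(** The factor [eps^6] per root is the price of the union bound over root sets.
    It costs [6 ln (1 / eps)] for [v] and [6 eps^2 |S| / 5000] for all other
    roots, against the gain [eps^2 |S| / 400] of [subset_exponent]. *)
Lemma poor_subset_explore_ge (R : realType) (n d : nat) (E : {set {set 'I_n}}) (eps : R)
    (H : regime d E eps) (F : {set {set 'I_n}}) (C S : {set 'I_n}) (v : 'I_n)
    (N := ext_nbhd F S) (rho := v |: [set x in S | [exists w in N, adj F x w]]) :
  F \subset E -> C \in components F -> S \subset C -> v \in S ->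
  eps ^+ 2 * n%:R / 50 <= #|S|%:R -> #|S|%:R <= 12 * eps * n%:R / 11 ->
  #|N|%:R < c0 * eps ^+ 2 * #|S|%:R / ln (1 / eps) ^+ 2 ->
  #|F :&: touching E N|%:R < eps ^+ 2 * #|S|%:R / (50 * 100 * ln (1 / eps)) ->
  expR (eps ^+ 4 * n%:R / (5 * 100 * 100)) <=
    eps ^+ 6 ^+ #|rho| * explore E (retention eps d) (eps ^+ 3) (two_phase_schedule n eps #|S|) (set0, rho, set0) F.
Proof.
move=> FE Ccomp SC vS Sge Sle Nlt Xlt.
have [y0 y1 y2] := eps3_bounds H; have e0 := eps_gt0 H; have e1 := eps_small H.
have n0 := order_gt0 H; have L1 := ln_inv_eps_ge1 H; have nl := order_large H.
have L0 : 0 < ln (1 / eps) by apply: lt_le_trans L1.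
have e20 : 0 < eps ^+ 2 by rewrite exprn_gt0.
have rS : rho \subset S.
  rewrite subUset sub1set vS; apply/subsetP => x; by rewrite inE => /andP[].
have Sn : (#|S| <= n)%N by rewrite -[X in (_ <= X)%N]card_ord max_card.
have [r0 r1] := early_rate_bounds H Sn.
have yx : eps ^+ 3 <= eps / 12 by clear -y1 e0; lra.
have x8 : eps / 12 <= 1 / 8 by clear -e1; lra.
have r8 : early_rate n eps #|S| <= 1 / 8 by apply: le_trans x8.
have jk : (#|S|./2 <= #|S|)%N by rewrite leq_half_double -addnn -addnS leq_addr.
have [a ak] := explore_two_phase_ge (degree_gt0 H) (regime_regular H) e0 (regime_mixing H) y0 (retention_le1 H) FE rS
  (boundary_spreads Ccomp SC vS) jk y2 r0 r8 yx x8 (zs := [::]) (fun z zin => match notF zin with end).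
rewrite cats0 -/(two_phase_schedule n eps #|S|) => hex.
have k50 : (50 <= #|S|)%N.
  rewrite -(ler_nat R); apply: le_trans Sge.
  have e3n : eps ^+ 5 * n%:R <= eps ^+ 2 * n%:R.
    rewrite ler_wpM2r ?(ltW n0) // -[eps ^+ 5]/(eps ^+ (2 + 3)) exprD ler_piMr ?(ltW e20) //.
  clear -e3n nl; lra.
have hX : #|rho|%:R <= 1 + #|F :&: touching E N|%:R :> R.
  rewrite -[X in X + _]/(1%:R) -natrD ler_nat.
  apply: leq_trans (leq_card_setU _ _) _; rewrite cards1 leq_add2l.
  apply: card_boundary => //; rewrite disjoint_sym disjoints_subset.
  by apply/subsetP => x; rewrite !inE => /andP[].
have e2S : 0 <= eps ^+ 2 * #|S|%:R by rewrite mulr_ge0 // ltW.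
apply: le_trans (ler_wpM2l _ hex); last by rewrite !exprn_ge0 // ltW.
rewrite [eps ^+ 6 ^+ _](_ : _ = expR (- (6 * ln (1 / eps)) * #|rho|%:R)); last first.
  by rewrite -[RHS]/(expR _) mulrC expRM_natl -expn_expR.
rewrite -expRD ler_expR ln_expn_inv //.
set k : R := #|S|%:R in Sge Sle Nlt Xlt e2S *.
apply: (@le_trans _ _ (- (6 * ln (1 / eps)) * #|rho|%:R + eps ^+ 2 * k / (4 * 100))); last first.
  rewrite lerD2l natrB //; apply: subset_exponent => //.
  - exact: half_ge.
  - rewrite ler_pdivlMr // -natrM ler_nat muln2 -[X in (_ <= X)%N](odd_double_half #|S|).
    exact: leq_addl.
  - by rewrite ler_nat.
  - move: Nlt; rewrite ltr_pdivlMr ?exprn_gt0 // => Nlt.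
    have m0 : 0 <= #|ext_nbhd F S|%:R :> R by [].
    have : #|ext_nbhd F S|%:R * ln (1 / eps) <= #|N|%:R * ln (1 / eps) ^+ 2.
      by rewrite ler_wpM2l // expr2 -[leLHS]mul1r ler_wpM2r // ltW.
    clear -Nlt e2S; lra.
have e4n : eps ^+ 4 * n%:R / 50 <= eps ^+ 2 * k.
  have -> : eps ^+ 4 * n%:R / 50 = eps ^+ 2 * (eps ^+ 2 * n%:R / 50) by field.
  by rewrite ler_wpM2l // ltW.
have LX : ln (1 / eps) * #|rho|%:R <= ln (1 / eps) + eps ^+ 2 * k / (50 * 100).
  apply: le_trans (_ : ln (1 / eps) * (1 + eps ^+ 2 * k / (50 * 100 * ln (1 / eps))) <= _).
    rewrite ler_wpM2l ?(ltW L0) //; apply: le_trans hX _.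
    by rewrite lerD2l ltW.
  by rewrite le_eqVlt; apply/orP; left; apply/eqP; field; rewrite gt_eqF.
have Le : ln (1 / eps) <= eps ^+ 4 * n%:R / (100 * 100 * (100 * 100)).
  apply: le_trans (ln_inv_le e0) _; rewrite ler_pdivrMr //.
  clear -nl; have -> : eps ^+ 4 * n%:R / (100 * 100 * (100 * 100)) * eps = eps ^+ 5 * n%:R / (100 * 100 * (100 * 100)) by ring.
  by lra.
clear -e4n LX Le e2S; lra.
Qed.

(** The edges contribute at least [eps^2 k / (10000 ln (1 / eps))] to the
    exponent and the vertices cost [6 ln (1 / eps)] each, which is
    [6 c0 eps^2 k / ln (1 / eps)] by the squared logarithm in the bound on
    [M]. *)
Lemma crowded_weight_ge (R : realType) (n d : nat) (E : {set {set 'I_n}}) (eps : R)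
    (H : regime d E eps) (F : {set {set 'I_n}}) (M : {set 'I_n}) (k : R) :
  eps ^+ 2 * n%:R / 50 <= k ->
  #|M|%:R < c0 * eps ^+ 2 * k / ln (1 / eps) ^+ 2 ->
  eps ^+ 2 * k / (50 * 100 * ln (1 / eps)) <= #|F :&: touching E M|%:R ->
  expR (eps ^+ 5 * n%:R / (2 * 100 * 100 * 100)) <= eps ^+ 6 ^+ #|M| * 2 ^+ #|F :&: touching E M|.
Proof.
move=> kge Mlt Xge.
have e0 := eps_gt0 H; have e1 := eps_small H; have L1 := ln_inv_eps_ge1 H.
have L0 : 0 < ln (1 / eps) by apply: lt_le_trans L1.
have e20 : 0 < eps ^+ 2 by rewrite exprn_gt0.
apply: (@le_trans _ _ (expR (- (6 * ln (1 / eps)) * #|M|%:R + 1 / 2 * #|F :&: touching E M|%:R))); last first.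
  rewrite expRD; apply: ler_pM; rewrite ?expR_ge0 //.
    by rewrite mulrC expRM_natl -expn_expR.
  rewrite mulrC expRM_natl lerXn2r ?nnegrE ?expR_ge0 //.
  exact: expR_half_le2.
rewrite ler_expR.
set w := eps ^+ 2 * k / ln (1 / eps).
have Mw : ln (1 / eps) * #|M|%:R <= c0 * w.
  have -> : c0 * w = ln (1 / eps) * (c0 * eps ^+ 2 * k / ln (1 / eps) ^+ 2) by rewrite /w; field; rewrite gt_eqF.
  by rewrite ler_pM2l // ltW.
have Xw : w / (50 * 100) <= #|F :&: touching E M|%:R.
  apply: le_trans Xge; rewrite le_eqVlt; apply/orP; left; apply/eqP; rewrite /w; field; by rewrite gt_eqF.
have wge : eps ^+ 5 * n%:R / 50 <= w.
  have -> : eps ^+ 5 * n%:R / 50 = eps ^+ 2 * (eps ^+ 2 * n%:R / 50) * eps by field.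
  apply: ler_pM; rewrite ?mulr_ge0 ?invr_ge0 ?(ltW e20) ?(ltW e0) //.
    by rewrite ler_pM2l.
  rewrite -[leLHS]invrK lef_pV2 ?posrE ?invr_gt0 //.
  by have := ln_inv_le e0; rewrite [leRHS]div1r.
have w0 : 0 <= w by apply: le_trans wge; rewrite !mulr_ge0 ?exprn_ge0 ?(ltW e0).
clear -Mw Xw wge w0; lra.
Qed.

(** * Expectations of the total weights *)

(** A degree of at least two is needed for [(1 + eps) / d] to be a probability.
    If [d = 1], the mixing inequality for a vertex and its only neighbour gives
    [1 <= 1 / n + eps^4]. *)
Lemma ndl_regime (R : realType) (n d : nat) (lam eps delta : R) (E : {set {set 'I_n}}) :
  0 < eps -> eps <= 1 / (100 * 100 * (100 * 100)) -> delta <= eps ^+ 4 ->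
  ndl_graph d lam E -> (0 < d)%N -> lam / d%:R <= delta ->
  100 * 100 * (100 * 100) <= eps ^+ 5 * n%:R -> regime d E eps.
Proof.
move=> e0 e1 de ndl d0 ld nl; have [sE rE _] := ndl.
have d0' : 0 < d%:R :> R by rewrite ltr0n.
have e14 : eps <= 1 / 4 by apply: le_trans e1 _; clear; lra.
have e4 : eps ^+ 4 <= 1 / 4.
  have -> : eps ^+ 4 = eps * eps ^+ 3 by ring.
  rewrite -[leRHS]mulr1; apply: ler_pM => //; rewrite ?exprn_ge0 ?(ltW e0) //.
  by rewrite exprn_ile1 ?(ltW e0) // (le_trans e14) //; clear; lra.
have mix : forall X Y : {set 'I_n},
      \sum_(v in X) #|[set w in Y | adj E v w]|%:R
        <= d%:R * #|X|%:R * #|Y|%:R / n%:R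
           + (eps ^+ 4 * d%:R) * (#|X|%:R + #|Y|%:R) / 2 :> R.
  move=> X Y; apply: expander_mixing ndl _ _ _ _ _.
  - by rewrite -ler_pdivrMr // (le_trans ld).
  - by rewrite mulr_gt0 // exprn_gt0.
  - rewrite -[ltRHS]mul1r ltr_pM2r //; clear -e4; lra.
have n4 : 4 <= n%:R :> R.
  apply: le_trans (_ : eps ^+ 5 * n%:R <= _).
    by apply: le_trans nl; clear; lra.
  by rewrite ler_piMl // exprn_ile1 ?(ltW e0) // (le_trans e14) //; clear; lra.
split=> //.
rewrite ler_pdivrMr // mul1r.
have d2 : (2 <= d)%N.
  rewrite ltn_neqAle d0 andbT; apply/eqP => d1.
  have n0 : (0 < n)%N by rewrite -(ltr_nat R); apply: lt_le_trans n4.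
  pose v := Ordinal n0; pose Y := [set w | adj E v w].
  have cY : #|Y| = 1%N by have /forallP/(_ v)/eqP -> := rE.
  have := mix [set v] Y; rewrite big_set1 cards1 cY -d1.
  have -> : [set w in Y | adj E v w] = Y by apply/setP => w; rewrite !inE andbb.
  rewrite cY !mul1r.
  have h : n%:R^-1 <= 4^-1 :> R by rewrite lef_pV2 ?posrE //; apply: lt_le_trans n4.
  clear -h e4; lra.
apply: le_trans (_ : 2%:R <= _); last by rewrite ler_nat.
clear -e14; lra.
Qed.

Section Expectations.
Variables (R : realType) (T : finType) (E : {set {set T}}) (p y : R).

Lemma expect_explore_root (zs : seq R) (rho : {set T}) :
  {in zs, forall z, 0 <= z /\ 0 < gain p y z} ->
  expect p E (explore E p y zs (set0, rho, set0)) = 1.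
Proof.
move=> zs0; have awE : away E set0 = E.
  by apply/setP => e; rewrite inE -setI_eq0 setI0 eqxx andbT.
rewrite -{1}awE; apply: (@expect_explore _ _ E p y zs (set0, rho, set0)).
  exact: sub0set.
by move=> z /zs0[_ /lt0r_neq0].
Qed.

(** This replaces estimates of binomial coefficients in the union bounds over
    root sets and over boundaries. *)
Lemma sum_sets_exp (t : R) : \sum_(M : {set T}) t ^+ #|M| = (1 + t) ^+ #|T|.
Proof.
rewrite addrC -[#|T|]cardsT -sum_powerset; apply: eq_big => M.
  by rewrite powersetE subsetT.
by rewrite expr1n mulr1.
Qed.

End Expectations.

Lemma expR_1D_exp (R : realType) (t : R) n : 0 <= t -> (1 + t) ^+ n <= expR (t * n%:R).
Proof.
move=> t0; rewrite mulrC expRM_natl lerXn2r ?nnegrE ?expR_ge0 ?expR_ge1Dx //.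
by rewrite addr_ge0.
Qed.

Lemma expRN_le (R : realType) (t : R) : 0 < t -> expR (- t) <= 2 / t ^+ 2.
Proof.
move=> t0; rewrite expRN -[leRHS]invf_div lef_pV2 ?posrE ?expR_gt0 ?divr_gt0 ?exprn_gt0 //.
exact/expR_ge_half_sqr/ltW.
Qed.

Section Witnesses.
Variables (R : realType) (n d : nat) (E : {set {set 'I_n}}) (eps : R).
Local Notation p := (retention eps d).
Local Notation y := (eps ^+ 3).

Definition connected_total (F : {set {set 'I_n}}) : R :=
  \sum_(v in [set: 'I_n]) explore E p y (flat_schedule n eps) (set0, [set v], set0) F.

(** The schedule depends on the size [k] of the explored set, so there is one
    sum over root sets for each size. *)
Definition subset_total (F : {set {set 'I_n}}) : R :=
  \sum_(k in [set: 'I_n.+1]) \sum_(rho in [set: {set 'I_n}])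
    eps ^+ 6 ^+ #|rho| * explore E p y (two_phase_schedule n eps k) (set0, rho, set0) F.

Definition degree_total (F : {set {set 'I_n}}) : R :=
  \sum_(M in [set: {set 'I_n}]) eps ^+ 6 ^+ #|M| * 2 ^+ #|F :&: touching E M|.

Hypothesis H : regime d E eps.

Lemma explore_regime_ge0 (zs : seq R) st (F : {set {set 'I_n}}) :
  {in zs, forall z, 0 <= z /\ 0 < gain p y z} -> 0 <= explore E p y zs st F.
Proof. by apply: explore_ge0; rewrite exprn_ge0 // ltW // (eps_gt0 H). Qed.

Lemma totals_ge0 (F : {set {set 'I_n}}) : [/\ 0 <= connected_total F, 0 <= subset_total F & 0 <= degree_total F].
Proof.
have e0 := ltW (eps_gt0 H); split; apply: sumr_ge0 => i _.
- exact: explore_regime_ge0 (flat_schedule_gain H).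
- apply: sumr_ge0 => rho _; rewrite mulr_ge0 ?exprn_ge0 // explore_regime_ge0 //.
  by apply: (two_phase_schedule_gain H); rewrite -ltnS ltn_ord.
- by rewrite mulr_ge0 ?exprn_ge0.
Qed.

Lemma expect_connected_total : expect p E connected_total = n%:R.
Proof.
rewrite /connected_total expect_sum (eq_bigr (fun=> 1)); last first.
  by move=> v _; apply: expect_explore_root (flat_schedule_gain H).
by rewrite sumr_const cardsT card_ord.
Qed.

Lemma expect_subset_total : expect p E subset_total = n.+1%:R * (1 + eps ^+ 6) ^+ n.
Proof.
rewrite /subset_total expect_sum (eq_bigr (fun=> (1 + eps ^+ 6) ^+ n)); last first.
  have -> : (1 + eps ^+ 6) ^+ n = \sum_(rho : {set 'I_n}) eps ^+ 6 ^+ #|rho|.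
    by rewrite sum_sets_exp card_ord.
  move=> k _; rewrite expect_sum.
  apply: eq_big => [rho|rho _]; first by rewrite inE.
  by rewrite expectZ expect_explore_root ?mulr1 //; apply: (two_phase_schedule_gain H); rewrite -ltnS ltn_ord.
by rewrite sumr_const cardsT card_ord mulr_natl.
Qed.

(** The mean of [2^X(M)] is [(1 + p)] to the number of edges of the graph that
    meet [M], which is at most [exp (p d |M|) <= 16^|M|]. *)
Lemma expect_degree_total_le : expect p E degree_total <= (1 + 16 * eps ^+ 6) ^+ n.
Proof.
have e0 := eps_gt0 H; have e1 := eps_small H.
have u0 : 0 <= eps ^+ 6 by rewrite exprn_ge0 // ltW.
have d0 : 0 < d%:R :> R by rewrite ltr0n (degree_gt0 H).
have -> : (1 + 16 * eps ^+ 6) ^+ n = \sum_(M : {set 'I_n}) (16 * eps ^+ 6) ^+ #|M|.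
  by rewrite sum_sets_exp card_ord.
rewrite /degree_total expect_sum.
rewrite (eq_bigl predT) => [|M]; last by rewrite inE.
apply: ler_sum => M _; rewrite expectZ expect_pow_inter; last first.
  by apply/subsetP => e; rewrite inE => /andP[].
have -> : 16 * eps ^+ 6 = eps ^+ 6 * 16 by rewrite mulrC.
rewrite [leRHS]exprMn ler_wpM2l ?exprn_ge0 ?(ltW e0) //.
have -> : 1 + p * (2 - 1) = 1 + p by ring.
have p0 : 0 <= p by rewrite divr_ge0 ?addr_ge0 ?(ltW d0) ?(ltW e0).
apply: le_trans (expR_1D_exp _ p0) _.
have h4 : expR 1 <= 4 :> R.
  have q0 : 0 < 1 / 4 :> R by lra.
  have := ln_inv_ge1 q0 (lexx _).
  have -> : 1 / (1 / 4) = 4 :> R by field.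
  by rewrite -[X in is_true X -> _]ler_expR lnK ?posrE.
have h16 : expR 2 <= 16 :> R.
  have -> : 2 = 1 + 1 :> R by [].
  rewrite expRD; have -> : 16 = 4 * 4 :> R by ring.
  by apply: ler_pM => //; apply: expR_ge0.
apply: (@le_trans _ _ (expR 2 ^+ #|M|)); last by rewrite lerXn2r ?nnegrE ?expR_ge0.
rewrite -expRM_natl ler_expR.
have := card_touching M (regime_simple H) (regime_regular H).
rewrite -(ler_nat R) natrM => ct.
apply: (@le_trans _ _ (p * (d%:R * #|M|%:R))); first by rewrite ler_wpM2l.
have -> : p * (d%:R * #|M|%:R) = #|M|%:R * (1 + eps) by field; rewrite gt_eqF.
by rewrite ler_wpM2l //; lra.
Qed.

Lemma connected_total_ge (F : {set {set 'I_n}}) (v : 'I_n) :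
  explore E p y (flat_schedule n eps) (set0, [set v], set0) F <= connected_total F.
Proof.
rewrite /connected_total (bigD1 v) ?inE //= lerDl sumr_ge0 // => i _.
exact: explore_regime_ge0 (flat_schedule_gain H).
Qed.

Lemma subset_total_ge (F : {set {set 'I_n}}) (k : nat) (rho : {set 'I_n}) : (k <= n)%N ->
  eps ^+ 6 ^+ #|rho| * explore E p y (two_phase_schedule n eps k) (set0, rho, set0) F <= subset_total F.
Proof.
move=> kn; have e0 := ltW (eps_gt0 H).
have pos (i : 'I_n.+1) (r : {set 'I_n}) :
    0 <= eps ^+ 6 ^+ #|r| * explore E p y (two_phase_schedule n eps i) (set0, r, set0) F.
  rewrite mulr_ge0 ?exprn_ge0 // explore_regime_ge0 //.
  by apply: (two_phase_schedule_gain H); rewrite -ltnS ltn_ord.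
have kn' : (k < n.+1)%N by [].
rewrite /subset_total (bigD1 (Ordinal kn')) ?inE //= (bigD1 rho) ?inE //= -addrA lerDl.
rewrite addr_ge0 // ?sumr_ge0 // => i _; first exact: (pos (Ordinal kn')).
exact: sumr_ge0.
Qed.

Lemma degree_total_ge (F : {set {set 'I_n}}) (M : {set 'I_n}) :
  eps ^+ 6 ^+ #|M| * 2 ^+ #|F :&: touching E M| <= degree_total F.
Proof.
have e0 := ltW (eps_gt0 H).
rewrite /degree_total (bigD1 M) ?inE //= lerDl sumr_ge0 // => i _.
by rewrite mulr_ge0 ?exprn_ge0.
Qed.

End Witnesses.

(** * Vertex expansion holds with high probability *)

Definition vertex_expansion (R : realType) (n : nat) (eps c : R)
    (Gp : {set {set 'I_n}}) : Prop :=
  forall L1 S : {set 'I_n}, largest_component Gp L1 -> S \subset L1 ->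
    (16 * ln (n%:R : R) / eps ^+ 2 <= #|S|%:R ->
     #|S|%:R <= eps ^+ 2 * n%:R / 50 ->
     connected_on Gp S ->
     c * eps ^+ 2 * #|S|%:R / ln (1 / eps) <= #|ext_nbhd Gp S|%:R)
    /\
    (eps ^+ 2 * n%:R / 50 <= #|S|%:R ->
     #|S|%:R <= 12 * eps * n%:R / 11 ->
     c * eps ^+ 2 * #|S|%:R / ln (1 / eps) ^+ 2 <= #|ext_nbhd Gp S|%:R).

(** The three total weights, each divided by the value that it exceeds when its
    kind of failure occurs. *)
Definition failure_bound (R : realType) (n d : nat) (E : {set {set 'I_n}}) (eps : R)
    (F : {set {set 'I_n}}) : R :=
  n%:R ^- 2 * connected_total d E eps F
  + (expR (eps ^+ 4 * n%:R / (5 * 100 * 100)))^-1 * subset_total d E eps F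
  + (expR (eps ^+ 5 * n%:R / (2 * 100 * 100 * 100)))^-1 * degree_total E eps F.

(** A small boundary of a linear set [S] either meets many retained edges, and
    the third weight is large, or leaves few roots, and the second one is. *)
Lemma failure_bound_ge1 (R : realType) (n d : nat) (E F : {set {set 'I_n}}) (eps : R) :
  regime d E eps -> F \subset E ->
  ~ vertex_expansion eps c0 F -> 1 <= failure_bound d E eps F.
Proof.
move=> H FE; have n0 := order_gt0 H; have e0 := eps_gt0 H.
have [w1 w2 w3] := totals_ge0 H F.
rewrite /failure_bound; set t2 := expR (eps ^+ 4 * _ / _); set t3 := expR _.
have t20 : 0 < t2 by apply: expR_gt0.
have t30 : 0 < t3 by apply: expR_gt0.
have n20 : 0 < n%:R ^+ 2 :> R by rewrite exprn_gt0.
have a1 : 0 <= n%:R ^- 2 * connected_total d E eps F by rewrite mulr_ge0 // invr_ge0 ltW.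
have a2 : 0 <= t2^-1 * subset_total d E eps F by rewrite mulr_ge0 // invr_ge0 ltW.
have a3 : 0 <= t3^-1 * degree_total E eps F by rewrite mulr_ge0 // invr_ge0 ltW.
have big1 : n%:R ^+ 2 <= connected_total d E eps F -> 1 <= n%:R ^- 2 * connected_total d E eps F + t2^-1 * subset_total d E eps F + t3^-1 * degree_total E eps F.
  move=> h; rewrite -addrA; apply: ler_wpDr; first exact: addr_ge0.
  by rewrite mulrC ler_pdivlMr // mul1r.
have big2 : t2 <= subset_total d E eps F -> 1 <= n%:R ^- 2 * connected_total d E eps F + t2^-1 * subset_total d E eps F + t3^-1 * degree_total E eps F.
  move=> h; apply: ler_wpDr => //; apply: ler_wpDl => //.
  by rewrite mulrC ler_pdivlMr // mul1r.
have big3 : t3 <= degree_total E eps F -> 1 <= n%:R ^- 2 * connected_total d E eps F + t2^-1 * subset_total d E eps F + t3^-1 * degree_total E eps F.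
  move=> h; apply: ler_wpDl; first exact: addr_ge0.
  by rewrite mulrC ler_pdivlMr // mul1r.
move: (_ + _) big1 big2 big3 => tot big1 big2 big3 nA.
rewrite leNgt; apply/negP => lt1; apply: nA => L1 S /andP[L1comp _] SL1.
have Sn : (#|S| <= n)%N by rewrite -[X in (_ <= X)%N]card_ord max_card.
split=> [Sge Sle conS|Sge Sle]; rewrite leNgt; apply/negP => Nlt; move: lt1; apply/negP; rewrite -leNgt.
  have [S0|[v vS]] := set_0Vmem S.
    by move: Nlt; rewrite S0 cards0 mulr0 mul0r ltNge ler0n.
  apply: big1; apply: le_trans (connected_total_ge H F v); exact: poor_connected_explore_ge Sge Sle Nlt.
have [S0|[v vS]] := set_0Vmem S.
  by move: Nlt; rewrite S0 cards0 mulr0 mul0r ltNge ler0n.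
have [Xlt|Xge] := ltP (#|F :&: touching E (ext_nbhd F S)|%:R : R)
  (eps ^+ 2 * #|S|%:R / (50 * 100 * ln (1 / eps))).
  apply: big2; exact: le_trans (poor_subset_explore_ge H FE L1comp SL1 vS Sge Sle Nlt Xlt) (subset_total_ge H F _ Sn).
apply: big3; exact: le_trans (crowded_weight_ge H Sge Nlt Xge) (degree_total_ge H F (ext_nbhd F S)).
Qed.

(** The factors [(1 + eps^6)^n] and [(1 + 16 eps^6)^n] of the union bounds are
    absorbed by half of the exponents [eps^4 n / 50000] and
    [eps^5 n / 2000000] in the denominators; the other halves are [alpha n] and
    [beta n]. *)
Lemma expect_failure_bound (R : realType) (n d : nat) (E : {set {set 'I_n}}) (eps : R)
    (alpha := eps ^+ 4 / (10 * 100 * 100)) (beta := eps ^+ 5 / (4 * 100 * 100 * 100)) :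
  regime d E eps ->
  expect (retention eps d) E (failure_bound d E eps)
    <= (1 + 4 / alpha ^+ 2 + 2 / beta ^+ 2) / n%:R.
Proof.
move=> H; have n0 := order_gt0 H; have e0 := eps_gt0 H; have e1 := eps_le H.
have es := eps_small H.
have nn1 : (1 <= n)%N by rewrite -(ltr_nat R).
have n1 : 1 <= n%:R :> R by rewrite ler1n.
have al0 : 0 < alpha by rewrite divr_gt0 ?exprn_gt0 //; clear; lra.
have be0 : 0 < beta by rewrite divr_gt0 ?exprn_gt0 //; clear; lra.
rewrite /failure_bound expectD expectD !expectZ (expect_connected_total H) (expect_subset_total H).
rewrite [leRHS]mulrDl [X in _ <= X + _]mulrDl; apply: lerD; first apply: lerD.
- by rewrite mul1r -exprVn expr2 -mulrA mulVf ?mulr1 // gt_eqF.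
- have u0 : 0 <= eps ^+ 6 by rewrite exprn_ge0 // ltW.
  have -> : (4 / alpha ^+ 2) / n%:R = (2 * n%:R) * (2 / (alpha * n%:R) ^+ 2).
    by field; rewrite !gt_eqF.
  rewrite mulrCA; apply: ler_pM; rewrite ?mulr_ge0 ?invr_ge0 ?expR_ge0 ?exprn_ge0 ?addr_ge0 //.
    rewrite -natrM ler_nat mul2n -addnn -addn1 leq_add2l //.
  apply: le_trans (expRN_le _); last by rewrite mulr_gt0.
  rewrite -expRN; apply: (@le_trans _ _ (expR (- (eps ^+ 4 * n%:R / (5 * 100 * 100))) * expR (eps ^+ 6 * n%:R))).
    by rewrite ler_wpM2l ?expR_ge0 // expR_1D_exp.
  rewrite -expRD ler_expR.
  have e42 : eps ^+ 6 * n%:R <= 1 / (100 * 100) * (1 / (100 * 100)) * (eps ^+ 4 * n%:R).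
    have -> : eps ^+ 6 * n%:R = eps * eps * (eps ^+ 4 * n%:R) by ring.
    rewrite ler_wpM2r ?mulr_ge0 ?exprn_ge0 ?(ltW e0) //.
    by apply: ler_pM; rewrite ?(ltW e0).
  have e4n : 0 <= eps ^+ 4 * n%:R by rewrite mulr_ge0 ?exprn_ge0 ?(ltW e0).
  by rewrite /alpha; clear -e42 e4n; lra.
have v0 : 0 <= 16 * eps ^+ 6 by rewrite mulr_ge0 ?exprn_ge0 // ltW.
apply: (@le_trans _ _ (expR (- (beta * n%:R)))); last first.
  apply: le_trans (expRN_le _) _; first by rewrite mulr_gt0.
  have -> : 2 / (beta * n%:R) ^+ 2 = 2 / beta ^+ 2 / n%:R * n%:R^-1.
    by field; rewrite !gt_eqF.
  rewrite ler_piMr ?divr_ge0 ?exprn_ge0 ?(ltW be0) // invf_le1 //.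
apply: (@le_trans _ _ (expR (- (eps ^+ 5 * n%:R / (2 * 100 * 100 * 100))) * expR (16 * eps ^+ 6 * n%:R))).
  rewrite -expRN ler_wpM2l ?expR_ge0 //; apply: le_trans (expect_degree_total_le H) _.
  exact: expR_1D_exp.
rewrite -expRD ler_expR /beta.
have e56 : eps ^+ 6 * n%:R <= 1 / (100 * 100 * (100 * 100)) * (eps ^+ 5 * n%:R).
  have -> : eps ^+ 6 * n%:R = eps * (eps ^+ 5 * n%:R) by ring.
  by rewrite ler_wpM2r ?mulr_ge0 ?exprn_ge0 ?(ltW e0).
have e5n : 0 <= eps ^+ 5 * n%:R by rewrite mulr_ge0 ?exprn_ge0 ?(ltW e0).
by clear -e56 e5n; lra.
Qed.

Lemma vertex_expansion_prob (R : realType) (n d : nat) (E : {set {set 'I_n}}) (eps : R)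
    (alpha := eps ^+ 4 / (10 * 100 * 100)) (beta := eps ^+ 5 / (4 * 100 * 100 * 100)) :
  regime d E eps ->
  1 - (1 + 4 / alpha ^+ 2 + 2 / beta ^+ 2) / n%:R
    <= perc_prob E (retention eps d) (vertex_expansion eps c0) <= 1.
Proof.
move=> H; have e0 := eps_gt0 H.
have p0 : 0 <= retention eps d by rewrite divr_ge0 // addr_ge0 // ltW.
have fb0 F : 0 <= failure_bound d E eps F.
  have [w1 w2 w3] := totals_ge0 H F.
  by rewrite !addr_ge0 ?mulr_ge0 ?invr_ge0 ?expR_ge0 ?exprn_ge0.
have [lo hi] := perc_prob_bounds p0 (retention_le1 H) fb0
  (fun F FE => @failure_bound_ge1 R n d E F eps H FE).
by rewrite hi andbT (le_trans _ lo) // lerB // expect_failure_bound.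
Qed.

Local Open Scope classical_set_scope.
Local Open Scope ring_scope.

Theorem theorem1 (R : realType) :
  exists eps0 c : R, 0 < eps0 /\ 0 < c /\
  forall eps delta : R, 0 < eps -> eps <= eps0 ->
  0 < delta -> delta <= eps ^+ 4 ->
  forall (n d : nat -> nat) (lam : nat -> R)
    (G : forall k : nat, {set {set 'I_(n k)}}),
  n k @[k --> \oo] --> \oo ->
  (forall k : nat, ndl_graph (d k) (lam k) (G k)) ->
  (forall k : nat, (0 < d k)%N) ->
  (forall k : nat, lam k / (d k)%:R <= delta) ->
  perc_prob (G k) ((1 + eps) / (d k)%:R)
    (fun Gp : {set {set 'I_(n k)}} =>
       forall L1 S : {set 'I_(n k)}, largest_component Gp L1 -> S \subset L1 ->
         (16 * ln ((n k)%:R : R) / eps ^+ 2 <= #|S|%:R ->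
          #|S|%:R <= eps ^+ 2 * (n k)%:R / 50 ->
          connected_on Gp S ->
          c * eps ^+ 2 * #|S|%:R / ln (1 / eps) <= #|ext_nbhd Gp S|%:R)
         /\
         (eps ^+ 2 * (n k)%:R / 50 <= #|S|%:R ->
          #|S|%:R <= 12 * eps * (n k)%:R / 11 ->
          c * eps ^+ 2 * #|S|%:R / ln (1 / eps) ^+ 2
            <= #|ext_nbhd Gp S|%:R))
    @[k --> \oo] --> (1 : R).
Proof.
exists (1 / (100 * 100 * (100 * 100))), (1 / (10 * 100 * 100)).
split; first lra.
split; first lra.
move=> eps delta e0 e1 _ de n d lam G n_oo ndl d0 ld.
pose K : R := 1 + 4 / (eps ^+ 4 / (10 * 100 * 100)) ^+ 2 + 2 / (eps ^+ 5 / (4 * 100 * 100 * 100)) ^+ 2.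
have K0 : 0 <= K.
  by rewrite !addr_ge0 ?divr_ge0 ?exprn_ge0 ?mulr_ge0 ?invr_ge0 ?exprn_ge0 ?(ltW e0).
apply/cvgrPdist_le => /= gap gap0.
have e5 : 0 < eps ^+ 5 by rewrite exprn_gt0.
have n_ooR : (n k)%:R @[k --> \oo] --> (+oo : set_system R) by apply/cvgrnyP.
near=> k.
have nk : (100 * 100 * (100 * 100)) / eps ^+ 5 + K / gap <= (n k)%:R.
  near: k; exact: (cvgryPge _).1 n_ooR _.
have nl : 100 * 100 * (100 * 100) <= eps ^+ 5 * (n k)%:R.
  rewrite [leRHS]mulrC -ler_pdivrMr //; apply: le_trans nk.
  by rewrite lerDl divr_ge0 // ltW.
have H := ndl_regime e0 e1 de (ndl k) (d0 k) (ld k) nl.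
have /andP[lo hi] := vertex_expansion_prob H.
rewrite ger0_norm ?subr_ge0 //.
rewrite lerBlDr -lerBlDl; apply: le_trans _ lo; rewrite lerB //.
rewrite ler_pdivrMr ?(order_gt0 H) // [leRHS]mulrC -ler_pdivrMr //.
apply: le_trans nk; by rewrite lerDr divr_ge0 ?(ltW e5) ?mulr_ge0 ?ler0n.
Unshelve. all: by end_near.
Qed.
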